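(* Let $(B,\diamond,\nu)$ be a Zinbiel bialgebra, $(D,\dashv,\vdash,\omega)$ a quadratic diassociative algebra, and $(D\otimes B,\cdot)$ the induced associative algebra, $(d_1\otimes b_1)\cdot(d_2\otimes b_2)=(d_1\vdash d_2)\otimes(b_1\diamond b_2)+(d_1\dashv d_2)\otimes(b_2\diamond b_1)$. Let $\Delta(d\otimes b)=\theta_{\vdash,\omega}(d)\bullet\nu(b)+\theta_{\dashv,\omega}(d)\bullet\tau(\nu(b))$. If $r=\sum_i x_i\otimes y_i\in B\otimes B$ is such that $r-\tau(r)$ is Zinb-invariant and $\nu=\nu_r$, then $(D\otimes B,\cdot,\Delta)=(D\otimes B,\cdot,\Delta_{\widehat r})$ as ASI bialgebras, where $\Delta_{\widehat r}(a)=(\mathrm{id}\otimes\mathbf l_{D\otimes B}(a)-\mathbf r_{D\otimes B}(a)\otimes\mathrm{id})(\widehat r)$ and $\widehat r=\sum_{i,j}(e_j\otimes x_i)\otimes(f_j\otimes y_i)$, with $\{e_j\}$ a basis of $D$ and $\{f_j\}$ its dual basis with respect to $\omega$ (i.e. $\omega(f_i,e_j)=\delta_{ij}$). Therefore: (i) $(D\otimes B,\cdot,\Delta)$ is quasi-triangular if $(B,\diamond,\nu)$ is quasi-triangular; (ii) $(D\otimes B,\cdot,\Delta)$ is triangular if $(B,\diamond,\nu)$ is triangular; (iii) $(D\otimes B,\cdot,\Delta)$ is factorizable if $(B,\diamond,\nu)$ is factorizable.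
   Context: All vector spaces are finite-dimensional over a field $\Bbbk$ of characteristic zero; $\tau(x\otimes y)=y\otimes x$; $(d'\otimes d'')\bullet(b'\otimes b''):=(d'\otimes b')\otimes(d''\otimes b'')$. For $s\in V\otimes V$, $s^\sharp:V^*\to V$ is defined by $\langle\xi_2,s^\sharp(\xi_1)\rangle=\langle\xi_1\otimes\xi_2,s\rangle$. Zinbiel algebra $(B,\diamond)$: $b_1\diamond(b_2\diamond b_3)=(b_1\diamond b_2)\diamond b_3+(b_2\diamond b_1)\diamond b_3$. Zinbiel coalgebra $(B,\nu)$: $(\mathrm{id}\otimes\nu)\nu=(\nu\otimes\mathrm{id})\nu+(\tau\otimes\mathrm{id})(\nu\otimes\mathrm{id})\nu$. With $\bar{\mathbf l}_B(b)(x)=b\diamond x$, $\bar{\mathbf r}_B(b)(x)=x\diamond b$, a Zinbiel bialgebra $(B,\diamond,\nu)$ is a Zinbiel algebra and coalgebra with $\nu(b_1\diamond b_2)+\nu(b_2\diamond b_1)=(\mathrm{id}\otimes(\bar{\mathbf l}_B+\bar{\mathbf r}_B)(b_2))\nu(b_1)+(\bar{\mathbf l}_B(b_1)\otimes\mathrm{id})\nu(b_2)$ and $\nu(b_1\diamond b_2)+\tau\nu(b_1\diamond b_2)=(\mathrm{id}\otimes\bar{\mathbf r}_B(b_2))\nu(b_1)+(\bar{\mathbf l}_B(b_1)\otimes\mathrm{id})(\nu(b_2)+\tau\nu(b_2))$. For $r\in B\otimes B$: $\nu_r(b)=\big(\bar{\mathbf l}_B(b)\otimes\mathrm{id}-\mathrm{id}\otimes(\bar{\mathbf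 l}_B+\bar{\mathbf r}_B)(b)\big)(r)$. An element $s\in B\otimes B$ is Zinb-invariant if $\big(\bar{\mathbf l}_B(b)\otimes\mathrm{id}-\mathrm{id}\otimes(\bar{\mathbf l}_B+\bar{\mathbf r}_B)(b)\big)(s)=0$ for all $b$. The Zinbiel Yang-Baxter equation (ZYBE) for $r=\sum_i x_i\otimes y_i$ is $\sum_{i,j}\big((x_i\diamond y_j)\otimes x_j\otimes y_i+(y_i\diamond x_j)\otimes x_i\otimes y_j+x_i\otimes(y_i\diamond x_j)\otimes y_j+x_j\otimes(x_i\diamond y_j)\otimes y_i-x_i\otimes x_j\otimes(y_i\diamond y_j)-x_j\otimes x_i\otimes(y_i\diamond y_j)-(x_i\diamond x_j)\otimes y_j\otimes y_i-y_j\otimes(x_i\diamond x_j)\otimes y_i\big)=0$. A Zinbiel bialgebra $(B,\diamond,\nu)$ is quasi-triangular if $\nu=\nu_r$ for some solution $r$ of the ZYBE with $r-\tau(r)$ Zinb-invariant; triangular if $\nu=\nu_r$ for some solution $r$ with $\tau(r)=r$; factorizable if it is quasi-triangular with such an $r$ for which $r^\sharp-\tau(r)^\sharp:B^*\to B$ is a linear isomorphism. Diassociative algebra $(D,\dashv,\vdash)$: two associative products with $(d_1\dashv d_2)\dashv d_3=d_1\dashv(d_2\vdash d_3)$, $(d_1\vdash d_2)\dashv d_3=d_1\vdash(d_2\dashv d_3)$, $(d_1\dashv d_2)\vdash d_3=(d_1\vdash d_2)\vdash d_3$. Quadratic: with a skew-symmetric nondegenerate form $\omega$ such that $\omega(d_1\vdash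 d_2,d_3)=\omega(d_1,d_2\vdash d_3-d_2\dashv d_3)$ and $\omega(d_1\dashv d_2,d_3)=\omega(d_1,d_2\vdash d_3)$. The maps $\theta_{\dashv,\omega},\theta_{\vdash,\omega}:D\to D\otimes D$ are given by $\omega(\theta_{\dashv,\omega}(d_1),d_2\otimes d_3)=\omega(d_1,d_2\dashv d_3)$, $\omega(\theta_{\vdash,\omega}(d_1),d_2\otimes d_3)=\omega(d_1,d_2\vdash d_3)$, where $\omega(a\otimes b,a'\otimes b')=\omega(a,a')\omega(b,b')$. ASI bialgebra $(A,\cdot,\Delta)$: $(A,\cdot)$ associative, $\Delta$ coassociative, and with $\mathbf l_A(a)(x)=a\cdot x$, $\mathbf r_A(a)(x)=x\cdot a$: $\Delta(a_1\cdot a_2)=(\mathbf r_A(a_2)\otimes\mathrm{id})\Delta(a_1)+(\mathrm{id}\otimes\mathbf l_A(a_1))\Delta(a_2)$ and $(\mathbf l_A(a_1)\otimes\mathrm{id}-\mathrm{id}\otimes\mathbf r_A(a_1))\Delta(a_2)=\tau\big((\mathrm{id}\otimes\mathbf r_A(a_2)-\mathbf l_A(a_2)\otimes\mathrm{id})\Delta(a_1)\big)$. For $s=\sum_i u_i\otimes v_i\in A\otimes A$ put $\Delta_s(a)=(\mathrm{id}\otimes\mathbf l_A(a)-\mathbf r_A(a)\otimes\mathrm{id})(s)$; $s$ is ass-invariant if $\Delta_s=0$; the AYBE is $\sum_{i,j}\big((u_i\cdot u_j)\otimes v_i\otimes v_j+u_i\otimes u_j\otimes(v_i\cdot v_j)-u_j\otimes(u_i\cdot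 v_j)\otimes v_i\big)=0$. The ASI bialgebra is quasi-triangular if $\Delta=\Delta_s$ for a solution $s$ of the AYBE with $s+\tau(s)$ ass-invariant; triangular if $\Delta=\Delta_s$ for a solution with $\tau(s)=-s$; factorizable if quasi-triangular with such $s$ for which $s^\sharp+\tau(s)^\sharp:A^*\to A$ is a linear isomorphism. *)

(* Defs.v *)
From mathcomp Require Import all_boot all_order all_algebra.

Set Implicit Arguments.
Unset Strict Implicit.
Unset Printing Implicit Defensive.

Import GRing.Theory.
Local Open Scope ring_scope.

Definition bilinear_op (K : fieldType) (U V W : lmodType K) (f : U -> V -> W) :
    Prop :=
  (forall y, linear (f^~ y)) /\ (forall x, linear (f x)).

(* V (x) W is modelled by the coefficient matrices with respect to the basis
   (b_i (x) c_j), where b and c are the library's bases of V and W. The lemmas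
   tlift_tens, linear_tlift and tlift_unique below are the universal property;
   all other maps out of a tensor product are defined with tlift, that is, by
   their values on pure tensors. *)
Definition tensor (K : fieldType) (V W : vectType K) : vectType K :=
  'M[K]_(\dim {:V}, \dim {:W}).

Definition tens (K : fieldType) (V W : vectType K) (x : V) (y : W) :
    tensor V W :=
  \matrix_(i, j) (coord (vbasis fullv) i x * coord (vbasis fullv) j y).

Notation "x ⊗ y" := (tens x y) (at level 35, right associativity) : ring_scope.

Definition tlift (K : fieldType) (V W : vectType K) (X : lmodType K)
    (f : V -> W -> X) (t : tensor V W) : X :=
  \sum_i \sum_j t i j *: f (vbasis fullv)`_i (vbasis fullv)`_j.

Section TensorTheory.
Variables (K : fieldType) (V W : vectType K) (X : lmodType K).

Lemma bilinear_tens : bilinear_op (@tens K V W).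
Proof.
split=> [y | x] a u v; apply/matrixP=> i j; rewrite !mxE linearP /=.
  by rewrite mulrDl mulrA.
by rewrite mulrDr mulrCA.
Qed.

Lemma linear_tlift (f : V -> W -> X) : linear (tlift f).
Proof.
move=> a s t; rewrite /tlift scaler_sumr -big_split /=.
apply: eq_bigr => i _; rewrite scaler_sumr -big_split /=.
by apply: eq_bigr => j _; rewrite !mxE scalerDl scalerA.
Qed.

Lemma tlift_tens (f : V -> W -> X) (x : V) (y : W) :
  bilinear_op f -> tlift f (x ⊗ y) = f x y.
Proof.
case=> fl fr.
have f0l v : f 0 v = 0 by have := fl v (-1) 0 0; rewrite !scaleN1r !addNr.
have f0r u : f u 0 = 0 by have := fr u (-1) 0 0; rewrite !scaleN1r !addNr.
have sl (n : nat) (c : 'I_n -> K) (g : 'I_n -> V) v :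
    f (\sum_i c i *: g i) v = \sum_i c i *: f (g i) v.
  by elim/big_rec2: _ => // i u w _ <-; apply: fl.
have sr (n : nat) (c : 'I_n -> K) (g : 'I_n -> W) u :
    f u (\sum_i c i *: g i) = \sum_i c i *: f u (g i).
  by elim/big_rec2: _ => // i v w _ <-; apply: fr.
rewrite [in RHS](coord_vbasis (memvf x)) [in RHS](coord_vbasis (memvf y)) sl.
apply: eq_bigr => i _; rewrite sr scaler_sumr.
by apply: eq_bigr => j _; rewrite mxE scalerA.
Qed.

Lemma tens_vbasis (i : 'I_(\dim {:V})) (j : 'I_(\dim {:W})) :
  (vbasis {:V})`_i ⊗ (vbasis {:W})`_j = delta_mx i j :> tensor V W.
Proof.
apply/matrixP=> k l; rewrite !mxE.
have/basis_free fV := vbasisP {:V}; have/basis_free fW := vbasisP {:W}.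
by rewrite !coord_free // -natrM mulnb (eq_sym i) (eq_sym j).
Qed.

Lemma tlift_unique (g : tensor V W -> X) :
  linear g -> forall t, g t = tlift (fun x y => g (x ⊗ y)) t.
Proof.
move=> gl t.
have g0 : g 0 = 0 by have := gl (-1) 0 0; rewrite !scaleN1r !addNr.
have gD u v : g (u + v) = g u + g v by have := gl 1 u v; rewrite !scale1r.
have gZ a u : g (a *: u) = a *: g u by have := gl a u 0; rewrite g0 !addr0.
rewrite {1}[t]matrix_sum_delta (big_morph g gD g0).
apply: eq_bigr => i _; rewrite (big_morph g gD g0).
by apply: eq_bigr => j _; rewrite gZ tens_vbasis.
Qed.

End TensorTheory.

Section TensorMaps.
Variable K : fieldType.

Definition tmap (V W V' W' : vectType K) (f : V -> V') (g : W -> W') :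
    tensor V W -> tensor V' W' :=
  tlift (fun x y => f x ⊗ g y).

Definition tflip (V W : vectType K) : tensor V W -> tensor W V :=
  tlift (fun x y => y ⊗ x).

Definition tassoc (U V W : vectType K) :
    tensor (tensor U V) W -> tensor U (tensor V W) :=
  tlift (fun s z => tlift (fun x y => x ⊗ y ⊗ z) s).

Definition tbullet (D B : vectType K) (s : tensor D D) (t : tensor B B) :
    tensor (tensor D B) (tensor D B) :=
  tlift (fun d' d'' => tlift (fun b' b'' => (d' ⊗ b') ⊗ (d'' ⊗ b'')) t) s.

Definition tsharp (V : vectType K) (s : tensor V V) (xi : 'Hom(V, K^o)) : V :=
  tlift (fun x y => (xi x : K) *: y) s.

Lemma tsharpE (V : vectType K) (s : tensor V V) (xi1 xi2 : 'Hom(V, K^o)) :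
  xi2 (tsharp s xi1) =
  tlift (X := K^o) (fun x y => (xi1 x : K) * (xi2 y : K)) s.
Proof.
rewrite /tsharp /tlift linear_sum.
have eqF (n : nat) (F G : 'I_n -> K^o) :
  (forall i, F i = G i) -> \sum_i F i = \sum_i G i by move=> FG; apply: eq_bigr.
apply: (eqF) => i; rewrite linear_sum; apply: (eqF) => j.
by rewrite linearZ linearZ.
Qed.

Definition linear_iso (V W : vectType K) (f : V -> W) : Prop :=
  linear f /\ bijective f.

End TensorMaps.

Section Zinbiel.
Variables (K : fieldType) (B : vectType K).
Variables (dia : B -> B -> B) (nu : B -> tensor B B).

Record zinbiel_algebra : Prop := ZinbielAlgebra {
  zinb_bilinear : bilinear_op dia;
  zinb_axiom : forall b1 b2 b3,
    dia b1 (dia b2 b3) = dia (dia b1 b2) b3 + dia (dia b2 b1) b3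
}.

Record zinbiel_coalgebra : Prop := ZinbielCoalgebra {
  zinb_colinear : linear nu;
  zinb_coaxiom : forall b,
    tmap id nu (nu b) =
      tassoc (tmap nu id (nu b))
      + tassoc (tmap (@tflip K B B) id (tmap nu id (nu b)))
}.

Let lr b x := dia b x + dia x b.

Record zinbiel_bialgebra : Prop := ZinbielBialgebra {
  zinb_algebra : zinbiel_algebra;
  zinb_coalgebra : zinbiel_coalgebra;
  zinb_compat1 : forall b1 b2,
    nu (dia b1 b2) + nu (dia b2 b1) =
      tmap id (lr b2) (nu b1) + tmap (dia b1) id (nu b2);
  zinb_compat2 : forall b1 b2,
    nu (dia b1 b2) + tflip (nu (dia b1 b2)) =
      tmap id (dia^~ b2) (nu b1) + tmap (dia b1) id (nu b2 + tflip (nu b2))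
}.

Definition zinb_cobound (r : tensor B B) (b : B) : tensor B B :=
  tmap (dia b) id r - tmap id (lr b) r.

Definition zinb_invariant (s : tensor B B) : Prop :=
  forall b, zinb_cobound s b = 0.

Definition zybe (r : tensor B B) : Prop :=
  tlift (fun xi yi => tlift (fun xj yj =>
      dia xi yj ⊗ xj ⊗ yi + dia yi xj ⊗ xi ⊗ yj
      + xi ⊗ dia yi xj ⊗ yj + xj ⊗ dia xi yj ⊗ yi
      - xi ⊗ xj ⊗ dia yi yj - xj ⊗ xi ⊗ dia yi yj
      - dia xi xj ⊗ yj ⊗ yi - yj ⊗ dia xi xj ⊗ yi) r) r
  = 0 :> tensor B (tensor B B).

Definition zinb_quasitriangular : Prop :=
  zinbiel_bialgebra /\
  exists r, [/\ nu =1 zinb_cobound r, zybe r & zinb_invariant (r - tflip r)].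

Definition zinb_triangular : Prop :=
  zinbiel_bialgebra /\
  exists r, [/\ nu =1 zinb_cobound r, zybe r & tflip r = r].

Definition zinb_factorizable : Prop :=
  zinbiel_bialgebra /\
  exists r, [/\ nu =1 zinb_cobound r, zybe r, zinb_invariant (r - tflip r)
    & linear_iso (fun xi => tsharp r xi - tsharp (tflip r) xi)].

End Zinbiel.

Section ASI.
Variables (K : fieldType) (A : vectType K).
Variables (mul : A -> A -> A) (Delta : A -> tensor A A).

Record asi_bialgebra : Prop := ASIBialgebra {
  asi_bilinear : bilinear_op mul;
  asi_assoc : associative mul;
  asi_colinear : linear Delta;
  asi_coassoc : forall a,
    tmap id Delta (Delta a) = tassoc (tmap Delta id (Delta a));
  asi_compat1 : forall a1 a2,
    Delta (mul a1 a2) =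
      tmap (mul^~ a2) id (Delta a1) + tmap id (mul a1) (Delta a2);
  asi_compat2 : forall a1 a2,
    tmap (mul a1) id (Delta a2) - tmap id (mul^~ a1) (Delta a2) =
      tflip (tmap id (mul^~ a2) (Delta a1) - tmap (mul a2) id (Delta a1))
}.

Definition asi_cobound (s : tensor A A) (a : A) : tensor A A :=
  tmap id (mul a) s - tmap (mul^~ a) id s.

Definition ass_invariant (s : tensor A A) : Prop :=
  forall a, asi_cobound s a = 0.

Definition aybe (s : tensor A A) : Prop :=
  tlift (fun ui vi => tlift (fun uj vj =>
      mul ui uj ⊗ vi ⊗ vj + ui ⊗ uj ⊗ mul vi vj
      - uj ⊗ mul ui vj ⊗ vi) s) s
  = 0 :> tensor A (tensor A A).

Definition asi_quasitriangular : Prop :=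
  asi_bialgebra /\
  exists s, [/\ Delta =1 asi_cobound s, aybe s & ass_invariant (s + tflip s)].

Definition asi_triangular : Prop :=
  asi_bialgebra /\
  exists s, [/\ Delta =1 asi_cobound s, aybe s & tflip s = - s].

Definition asi_factorizable : Prop :=
  asi_bialgebra /\
  exists s, [/\ Delta =1 asi_cobound s, aybe s, ass_invariant (s + tflip s)
    & linear_iso (fun xi => tsharp s xi + tsharp (tflip s) xi)].

End ASI.

Section Diassociative.
Variables (K : fieldType) (D : vectType K).
(* dl is the product written with a left tack (-|), dr the one with a right
   tack (|-). *)
Variables (dl dr : D -> D -> D) (omega : D -> D -> K).

Record diassociative_algebra : Prop := DiassociativeAlgebra {
  dl_bilinear : bilinear_op dl;
  dr_bilinear : bilinear_op dr;
  dl_assoc : associative dl;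
  dr_assoc : associative dr;
  dlldr : forall d1 d2 d3, dl (dl d1 d2) d3 = dl d1 (dr d2 d3);
  drldl : forall d1 d2 d3, dl (dr d1 d2) d3 = dr d1 (dl d2 d3);
  dlrdr : forall d1 d2 d3, dr (dl d1 d2) d3 = dr (dr d1 d2) d3
}.

Record quadratic_diassociative_algebra : Prop := QuadraticDiassociative {
  quad_diass : diassociative_algebra;
  quad_bilinear : bilinear_op (W := K^o) omega;
  quad_skew : forall d1 d2, omega d1 d2 = - omega d2 d1;
  quad_nondeg : forall d1, (forall d2, omega d1 d2 = 0) -> d1 = 0;
  quad_dr : forall d1 d2 d3,
    omega (dr d1 d2) d3 = omega d1 (dr d2 d3 - dl d2 d3);
  quad_dl : forall d1 d2 d3, omega (dl d1 d2) d3 = omega d1 (dr d2 d3)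
}.

Definition form2 (s t : tensor D D) : K :=
  tlift (X := K^o) (fun a b =>
    tlift (X := K^o) (fun a' b' => omega a a' * omega b b') t) s.

(* By nondegeneracy of omega this determines theta, for a given product op. *)
Definition form_coproduct (op : D -> D -> D) (theta : D -> tensor D D) : Prop :=
  forall d1 d2 d3, form2 (theta d1) (d2 ⊗ d3) = omega d1 (op d2 d3).

Definition dual_bases (n : nat) (e f : n.-tuple D) : Prop :=
  basis_of fullv e /\
  forall i j : 'I_n, omega (tnth f i) (tnth e j) = (i == j)%:R.

End Diassociative.

Section Induced.
Variables (K : fieldType) (D B : vectType K).

Definition induced_mul (dl dr : D -> D -> D) (dia : B -> B -> B)
    (a1 a2 : tensor D B) : tensor D B :=
  tlift (fun d1 b1 => tlift (fun d2 b2 =>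
    dr d1 d2 ⊗ dia b1 b2 + dl d1 d2 ⊗ dia b2 b1) a2) a1.

Definition induced_comul (thetal thetar : D -> tensor D D)
    (nu : B -> tensor B B) : tensor D B -> tensor (tensor D B) (tensor D B) :=
  tlift (fun d b =>
    tbullet (thetar d) (nu b) + tbullet (thetal d) (tflip (nu b))).

Definition induced_r (n : nat) (e f : n.-tuple D) (r : tensor B B) :
    tensor (tensor D B) (tensor D B) :=
  \sum_(j < n) tlift (fun x y => (tnth e j ⊗ x) ⊗ (tnth f j ⊗ y)) r.

End Induced.

(* Main.v *)
(** Contracting the factor D of D (x) B against vectors of D through omega gives
    maps D (x) B -> B that jointly separate points, and so do their tensor
    powers. Contracted with x and y, Delta becomes
    nu o (contraction with x |- y) + tau nu o (contraction with x -| y), products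
    in D (x) B become Zinbiel products, and the tensor induced by r becomes
    omega(y, x) r. The diassociative axioms and the invariance of omega leave at
    most three coefficients, the values of omega at x |- y |- z, x |- y -| z and
    x -| y -| z, and the coefficient of each is an identity in the Zinbiel
    bialgebra B. For the AYBE there are two such identities, both consequences of
    the ZYBE and the invariance of r - tau(r). For factorizability, sharp of
    the induced tensor is sharp of r - tau(r) applied coordinatewise. *)

Require Import Defs.
From HB Require Import structures.
From mathcomp Require Import all_boot all_order all_algebra ring.

Set Implicit Arguments.
Unset Strict Implicit.
Unset Printing Implicit Defensive.

Import GRing.Theory.
Local Open Scope ring_scope.

(** * Linearity of unbundled functions *)

Section LinearMaps.
Variables (K : fieldType) (U V W : lmodType K).
Implicit Types (f g : U -> V) (h : V -> W).

Lemma linear_fD f : linear f -> forall u v, f (u + v) = f u + f v.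
Proof. by move=> lf u v; have := lf 1 u v; rewrite !scale1r. Qed.

Lemma linear_f0 f : linear f -> f 0 = 0.
Proof. by move=> lf; have := lf (-1) 0 0; rewrite !scaleN1r !addNr. Qed.

Lemma linear_fZ f : linear f -> forall a u, f (a *: u) = a *: f u.
Proof. by move=> lf a u; have := lf a u 0; rewrite (linear_f0 lf) !addr0. Qed.

Lemma linear_fN f : linear f -> forall u, f (- u) = - f u.
Proof. by move=> lf u; rewrite -scaleN1r (linear_fZ lf) scaleN1r. Qed.

Lemma linear_fB f : linear f -> forall u v, f (u - v) = f u - f v.
Proof. by move=> lf u v; rewrite (linear_fD lf) (linear_fN lf). Qed.

Lemma linear_fsum f (I : Type) (r : seq I) (P : pred I) (F : I -> U) :
  linear f -> f (\sum_(i <- r | P i) F i) = \sum_(i <- r | P i) f (F i).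
Proof. by move=> lf; apply: (big_morph f (linear_fD lf) (linear_f0 lf)). Qed.

Lemma linear_fun_id : linear (fun x : U => x).
Proof. by []. Qed.

Lemma linear_fun_comp f h : linear h -> linear f -> linear (fun x => h (f x)).
Proof. by move=> lh lf a u v; rewrite lf lh. Qed.

Lemma linear_fun_add f g : linear f -> linear g -> linear (fun x => f x + g x).
Proof. by move=> lf lg a u v; rewrite lf lg scalerDr addrACA. Qed.

Lemma linear_fun_opp f : linear f -> linear (fun x => - f x).
Proof. by move=> lf a u v; rewrite lf opprD scalerN. Qed.

Lemma linear_fun_scale c f : linear f -> linear (fun x => c *: f x).
Proof. by move=> lf a u v; rewrite lf scalerDr !scalerA mulrC. Qed.

Lemma linear_fun_zero : linear (fun _ : U => 0 : V).
Proof. by move=> a u v; rewrite scaler0 addr0. Qed.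

Lemma linear_fun_sum (I : Type) (r : seq I) (F : I -> U -> V) :
  (forall i, linear (F i)) -> linear (fun x => \sum_(i <- r) F i x).
Proof.
move=> lF a u v; rewrite scaler_sumr -big_split /=.
by apply: eq_bigr => i _; rewrite lF.
Qed.

Lemma linear_fun_scalel (f : U -> K) (y : V) :
  linear (f : U -> K^o) -> linear (fun x => f x *: y).
Proof. by move=> lf a u v; rewrite lf scalerDl scalerA. Qed.

End LinearMaps.

(** * Linearity of the tensor operations *)

Section TensorCalculus.
Variable K : fieldType.
Implicit Types U V W : vectType K.

Lemma linear_tensl V W (y : W) : linear (fun x : V => x ⊗ y).
Proof. by have [] := bilinear_tens V W. Qed.

Lemma linear_tensr V W (x : V) : linear (fun y : W => x ⊗ y).
Proof. by have [_] := bilinear_tens V W. Qed.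

Lemma linear_fun_tlift V W (X Y : lmodType K) (f : V -> W -> X -> Y) t :
  (forall x y, linear (f x y)) -> linear (fun z => tlift (fun x y => f x y z) t).
Proof.
move=> lf; rewrite /tlift.
by do 2!apply: linear_fun_sum => ?; apply: linear_fun_scale; apply: lf.
Qed.

Lemma linear_tmap V W V' W' (f : V -> V') (g : W -> W') : linear (tmap f g).
Proof. exact: linear_tlift. Qed.

Lemma linear_tflip V W : linear (@tflip K V W).
Proof. exact: linear_tlift. Qed.

Lemma linear_tassoc U V W : linear (@tassoc K U V W).
Proof. exact: linear_tlift. Qed.

(** These instances make the generic [linearD], [linearN] and [linearZ] available for maps that are
    otherwise handled as plain functions. *)
HB.instance Definition _ V W (X : lmodType K) (f : V -> W -> X) :=
  GRing.isLinear.Build K (tensor V W) X _ (tlift f) (linear_tlift f).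
HB.instance Definition _ V W V' W' (f : V -> V') (g : W -> W') :=
  GRing.isLinear.Build K (tensor V W) (tensor V' W') _ (tmap f g)
    (linear_tmap f g).
HB.instance Definition _ V W :=
  GRing.isLinear.Build K (tensor V W) (tensor W V) _ (@tflip K V W)
    (@linear_tflip V W).
HB.instance Definition _ U V W :=
  GRing.isLinear.Build K (tensor (tensor U V) W) (tensor U (tensor V W)) _
    (@tassoc K U V W) (@linear_tassoc U V W).

End TensorCalculus.

Ltac lin_side :=
  cbv beta;
  first
    [ match goal with
      | H : GRing.linear_for _ _ |- _ => exact H
      | H : forall _, GRing.linear_for _ _ |- _ => exact (H _)
      | H : forall _ _, GRing.linear_for _ _ |- _ => exact (H _ _)
      end
    | exact (linear_tensl _) | exact (linear_tensr _) | exact (linear_tlift _)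
    | exact (linear_tmap _ _) | exact (@linear_tflip _ _ _)
    | exact (@linear_tassoc _ _ _ _) | exact (@linear_fun_id _ _)
    | exact (linear_fun_scale _ (@linear_fun_id _ _)) ].

(* [lin] proves that an explicit expression is linear in its bound variable, the
   functions that occur in it being linear by hypothesis or known to be so. *)
Ltac lin_step :=
  match goal with
  | |- bilinear_op _ => split; intro
  | |- forall _, _ => intro
  | |- GRing.linear_for _ (fun x => x) => exact: linear_fun_id
  | |- GRing.linear_for _ (fun x => 0) => exact: linear_fun_zero
  | |- GRing.linear_for _ (fun x => @?f x + @?g x) =>
      refine (@linear_fun_add _ _ _ f g _ _)
  | |- GRing.linear_for _ (fun x => - @?f x) =>
      refine (@linear_fun_opp _ _ _ f _)
  | |- GRing.linear_for _ (fun x => ?c *: @?f x) =>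
      refine (@linear_fun_scale _ _ _ c f _)
  | |- GRing.linear_for _ (fun x => @?f x *: ?c) =>
      refine (@linear_fun_scalel _ _ _ f c _)
  | |- GRing.linear_for _ (fun x => bigop _ _ _) =>
      apply: linear_fun_sum => ?
  | |- _ => lin_side
  | |- GRing.linear_for _ (fun x => ?h (@?f x)) =>
      refine (@linear_fun_comp _ _ _ _ f h _ _); [lin_side | ]
  | |- GRing.linear_for _ (fun x => ?op (@?f x) ?c) =>
      refine (@linear_fun_comp _ _ _ _ f (fun y => op y c) _ _);
      [lin_side | ]
  | |- GRing.linear_for _ (fun x => tlift _ ?t) =>
      apply: linear_fun_tlift => ? ?
  end.

Ltac lin := repeat (cbv beta; lin_step).

(** * Maps determined by their values on pure tensors *)

Section TensorExtensionality.
Variable K : fieldType.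
Implicit Types U V W : vectType K.

Lemma tensor_ext V W (X : lmodType K) (g h : tensor V W -> X) :
  linear g -> linear h -> (forall x y, g (x ⊗ y) = h (x ⊗ y)) -> g =1 h.
Proof.
move=> lg lh gh t; rewrite (tlift_unique lg) (tlift_unique lh) /tlift.
by do 2!apply: eq_bigr => ? _; rewrite gh.
Qed.

Lemma eq_tlift V W (X : lmodType K) (f g : V -> W -> X) t :
  (forall x y, f x y = g x y) -> tlift f t = tlift g t.
Proof. by move=> fg; do 2!apply: eq_bigr => ? _; rewrite fg. Qed.

Lemma eq_tmap V W V' W' (f f' : V -> V') (g g' : W -> W') :
  f =1 f' -> g =1 g' -> tmap f g =1 tmap f' g'.
Proof. by move=> ff' gg' t; apply: eq_tlift => x y; rewrite ff' gg'. Qed.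

Lemma comp_tlift V W (X Y : lmodType K) (h : X -> Y) (f : V -> W -> X) t :
  linear h -> h (tlift f t) = tlift (fun x y => h (f x y)) t.
Proof.
move=> lh; rewrite /tlift (linear_fsum _ _ _ lh); apply: eq_bigr => i _.
by rewrite (linear_fsum _ _ _ lh); apply: eq_bigr => j _; rewrite (linear_fZ lh).
Qed.

Lemma tensDl V W (x x' : V) (y : W) : (x + x') ⊗ y = x ⊗ y + x' ⊗ y.
Proof. exact: linear_fD (linear_tensl y) x x'. Qed.

Lemma tensDr V W (x : V) (y y' : W) : x ⊗ (y + y') = x ⊗ y + x ⊗ y'.
Proof. exact: linear_fD (linear_tensr x) y y'. Qed.

Lemma tensNl V W (x : V) (y : W) : (- x) ⊗ y = - (x ⊗ y).
Proof. exact: linear_fN (linear_tensl y) x. Qed.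

Lemma tensNr V W (x : V) (y : W) : x ⊗ (- y) = - (x ⊗ y).
Proof. exact: linear_fN (linear_tensr x) y. Qed.

Lemma tensZl V W a (x : V) (y : W) : (a *: x) ⊗ y = a *: (x ⊗ y).
Proof. exact: linear_fZ (linear_tensl y) a x. Qed.

Lemma tensZr V W a (x : V) (y : W) : x ⊗ (a *: y) = a *: (x ⊗ y).
Proof. exact: linear_fZ (linear_tensr x) a y. Qed.

Lemma tmap_tens V W V' W' (f : V -> V') (g : W -> W') x y :
  linear f -> linear g -> tmap f g (x ⊗ y) = f x ⊗ g y.
Proof. by move=> lf lg; apply: tlift_tens; lin. Qed.

Lemma tflip_tens V W (x : V) (y : W) : tflip (x ⊗ y) = y ⊗ x.
Proof. by apply: tlift_tens; lin. Qed.

Lemma tassoc_tens U V W (x : U) (y : V) (z : W) :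
  tassoc ((x ⊗ y) ⊗ z) = x ⊗ y ⊗ z.
Proof.
rewrite /tassoc tlift_tens; last by lin.
by rewrite tlift_tens //; lin.
Qed.

Lemma tflipK V W : cancel (@tflip K V W) (@tflip K W V).
Proof. by apply: tensor_ext; [lin | lin | move=> x y; rewrite !tflip_tens]. Qed.

Lemma tmap_id V W : tmap id id =1 @id (tensor V W).
Proof. by apply: tensor_ext; [lin | lin | move=> x y; rewrite tmap_tens]. Qed.

Lemma tmapDr V W V' W' (f : V -> V') (g g' : W -> W') t :
  tmap f (fun x => g x + g' x) t = tmap f g t + tmap f g' t.
Proof.
rewrite /tmap /tlift -big_split; apply: eq_bigr => i _ /=.
rewrite -big_split; apply: eq_bigr => j _ /=.
by rewrite tensDr scalerDr.
Qed.

Lemma tmapD V W V' W' (f : V -> V') (g : W -> W') s t :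
  tmap f g (s + t) = tmap f g s + tmap f g t.
Proof. exact: linearD. Qed.

Lemma tmapN V W V' W' (f : V -> V') (g : W -> W') t :
  tmap f g (- t) = - tmap f g t.
Proof. exact: linearN. Qed.

Lemma tmapZ V W V' W' (f : V -> V') (g : W -> W') a t :
  tmap f g (a *: t) = a *: tmap f g t.
Proof. exact: linearZ. Qed.

Lemma tflipD V W (s t : tensor V W) : tflip (s + t) = tflip s + tflip t.
Proof. exact: linearD. Qed.

Lemma tflipN V W (t : tensor V W) : tflip (- t) = - tflip t.
Proof. exact: linearN. Qed.

Lemma tflipZ V W a (t : tensor V W) : tflip (a *: t) = a *: tflip t.
Proof. exact: linearZ. Qed.

Lemma tassocD U V W (s t : tensor (tensor U V) W) :
  tassoc (s + t) = tassoc s + tassoc t.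
Proof. exact: linearD. Qed.

Lemma tassocZ U V W a (t : tensor (tensor U V) W) :
  tassoc (a *: t) = a *: tassoc t.
Proof. exact: linearZ. Qed.

Lemma tmap_comp V W V' W' V'' W'' (f : V -> V') (g : W -> W')
    (f' : V' -> V'') (g' : W' -> W'') t :
  linear f -> linear g -> linear f' -> linear g' ->
  tmap f' g' (tmap f g t) = tmap (f' \o f) (g' \o g) t.
Proof.
move=> lf lg lf' lg'; move: t; apply: tensor_ext; [lin | lin | move=> x y].
have lff : linear (f' \o f) by apply: linear_fun_comp.
have lgg : linear (g' \o g) by apply: linear_fun_comp.
by rewrite !tmap_tens.
Qed.

Lemma tflip_tmap V W V' W' (f : V -> V') (g : W -> W') t :
  linear f -> linear g -> tflip (tmap f g t) = tmap g f (tflip t).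
Proof.
move=> lf lg; move: t; apply: tensor_ext; [lin | lin | move=> x y].
by rewrite tflip_tens !tmap_tens // tflip_tens.
Qed.

End TensorExtensionality.

(** * Permutations of three tensor factors *)

Section TripleTensors.
Variable K : fieldType.
Implicit Types U V W : vectType K.

Lemma tensor_ext3 U V W (X : lmodType K) (g h : tensor (tensor U V) W -> X) :
  linear g -> linear h ->
  (forall x y z, g ((x ⊗ y) ⊗ z) = h ((x ⊗ y) ⊗ z)) -> g =1 h.
Proof.
move=> lg lh gh; apply: tensor_ext => // s z.
apply: (tensor_ext (g := fun s => g (s ⊗ z)) (h := fun s => h (s ⊗ z))).
- by lin.
- by lin.
- by move=> x y; apply: gh.
Qed.

Lemma tassoc_tmap_tens U V W U' V' W' (f : U -> U') (g : V -> V') (h : W -> W')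
    t :
  linear f -> linear g -> linear h ->
  tmap f (tmap g h) (tassoc t) = tassoc (tmap (tmap f g) h t).
Proof.
move=> lf lg lh; move: t; apply: tensor_ext3; [lin | lin | move=> x y z].
rewrite tassoc_tens !tmap_tens //; try by lin.
by rewrite tassoc_tens.
Qed.

(** As permutations, (23) is (12) followed by the cyclic rotation [x ⊗ y ⊗ z] to [y ⊗ z ⊗ x]. The
    coalgebra axiom is symmetric under (12), so (23) acts on it as that rotation. *)
Lemma swap_last_tassoc U V W (u : tensor (tensor U V) W) :
  tmap id (@tflip K V W) (tassoc u) =
  tassoc (tflip (tassoc (tmap (@tflip K U V) id u))).
Proof.
move: u; apply: tensor_ext3; [lin | lin | move=> x y z].
rewrite tassoc_tens !tmap_tens ?tflip_tens //; try by lin.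
by rewrite tassoc_tens tflip_tens tassoc_tens.
Qed.

(** Both sides reverse the order of the three factors; this is the form in which the coalgebra axiom
    gets reversed. *)
Lemma swap_last_tflip U V W (u : tensor (tensor U V) W) :
  tmap id (@tflip K U V) (tflip u) =
  tassoc (tmap (@tflip K V W) id (tflip (tassoc u))).
Proof.
move: u; apply: tensor_ext3; [lin | lin | move=> x y z].
rewrite tassoc_tens !tflip_tens !tmap_tens ?tflip_tens //; try by lin.
by rewrite tassoc_tens.
Qed.

End TripleTensors.

(** * Two permuted forms of the Zinbiel coalgebra axiom *)

Section ZinbielCoalgebra.
Variables (K : fieldType) (B : vectType K) (nu : B -> tensor B B).
Hypothesis nuP : zinbiel_coalgebra nu.

Let lin_nu : linear nu := zinb_colinear nuP.

Let tflipKt (u : tensor (tensor B B) B) :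
  tmap (@tflip K B B) id (tmap (@tflip K B B) id u) = u.
Proof.
rewrite tmap_comp; try by lin.
by rewrite -[RHS]tmap_id; apply: eq_tmap => // t; apply: tflipK.
Qed.

(** By the axiom, [(id ⊗ nu) nu] is invariant under exchange of its first two factors, so exchanging
    the last two is the same as rotating cyclically, and its rotation is [(nu ⊗ id) tau nu]. *)
Lemma zinbiel_coalgebra_swap_last b :
  tmap id (fun x => tflip (nu x)) (nu b) = tassoc (tmap nu id (tflip (nu b))).
Proof.
rewrite -(@tflip_tmap K _ _ _ _ id nu) //.
rewrite -(@tmap_comp K _ _ _ _ _ _ id nu id (@tflip K B B)) //; try by lin.
rewrite (zinb_coaxiom nuP) !linearD /= !swap_last_tassoc tflipKt.
exact: addrC.
Qed.

(** This is the axiom with the three factors in reverse order: [(id ⊗ nu) nu] becomes the right-hand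
    side, and the two summands of the axiom become the two on the left, in the opposite order. *)
Lemma zinbiel_coalgebra_reverse b :
  tmap id nu (tflip (nu b)) + tmap id (fun x => tflip (nu x)) (tflip (nu b)) =
  tassoc (tmap (fun x => tflip (nu x)) id (tflip (nu b))).
Proof.
rewrite -(@tmap_comp K _ _ _ _ _ _ id nu id (@tflip K B B)) //; try by lin.
rewrite -(@tmap_comp K _ _ _ _ _ _ nu id (@tflip K B B) id) //; try by lin.
rewrite -(@tflip_tmap K _ _ _ _ nu id) // -(@tflip_tmap K _ _ _ _ id nu) //.
rewrite (zinb_coaxiom nuP) !linearD /= -!swap_last_tflip.
rewrite [RHS]addrC; congr (_ + _).
by rewrite -[in RHS]tflip_tmap ?tflipKt //; lin.
Qed.

End ZinbielCoalgebra.

(** * Jointly separating families and their tensor products *)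

Section SeparatingFamilies.
Variable K : fieldType.
Implicit Types V W : vectType K.

(** Separation is encoded as a finite linear reconstruction rather than as joint injectivity,
    because a reconstruction passes directly to tensor products. *)
Definition separating (I : Type) V W (phi : I -> V -> W) : Prop :=
  (forall i, linear (phi i)) /\
  exists (J : finType) (ind : J -> I) (psi : J -> W -> V),
    (forall j, linear (psi j)) /\
    (forall v, v = \sum_j psi j (phi (ind j) v)).

Lemma separating_inj (I : Type) V W (phi : I -> V -> W) u v :
  separating phi -> (forall i, phi i u = phi i v) -> u = v.
Proof.
move=> [_ [J [ind [psi [_ psiP]]]]] uv; rewrite (psiP u) (psiP v).
by apply: eq_bigr => j _; rewrite uv.
Qed.

(** On a pure tensor, each factor is expanded by its own reconstruction and the product of the two
    sums is multiplied out. *)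
Lemma separating_tmap (I I' : Type) V W V' W'
    (phi : I -> V -> W) (phi' : I' -> V' -> W') :
  separating phi -> separating phi' ->
  separating (fun i : I * I' => tmap (phi i.1) (phi' i.2)).
Proof.
move=> [lphi [J [ind [psi [lpsi psiP]]]]].
move=> [lphi' [J' [ind' [psi' [lpsi' psiP']]]]].
split; first by move=> i; lin.
exists (J * J')%type, (fun j => (ind j.1, ind' j.2)).
exists (fun j => tmap (psi j.1) (psi' j.2)).
split; first by move=> j; lin.
apply: tensor_ext; [lin | lin | move=> x y].
rewrite [in LHS](psiP x) [in LHS](psiP' y).
rewrite (linear_fsum _ _ _ (linear_tensl _)) -(pair_bigA _ (fun j j' =>
  tmap (psi j) (psi' j') (tmap (phi (ind j)) (phi' (ind' j')) (x ⊗ y)))) /=.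
apply: eq_bigr => j _; rewrite (linear_fsum _ _ _ (linear_tensr _)).
by apply: eq_bigr => j' _; rewrite !tmap_tens.
Qed.

End SeparatingFamilies.

(** * Dual bases and contraction through a nondegenerate form *)

Section NondegenerateForm.
Variables (K : fieldType) (D : vectType K) (omega : D -> D -> K).
Hypothesis omega_bil : bilinear_op (W := K^o) omega.
Hypothesis omega_nondeg : forall d1, (forall d2, omega d1 d2 = 0) -> d1 = 0.

Let lin_oml y : linear (fun x => omega x y : K^o).
Proof. exact: omega_bil.1. Qed.
Let lin_omr x : linear (omega x : D -> K^o).
Proof. exact: omega_bil.2. Qed.

Lemma form_suml (I : Type) (r : seq I) (F : I -> D) (c : I -> K) d :
  omega (\sum_(i <- r) c i *: F i) d = \sum_(i <- r) c i * omega (F i) d.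
Proof.
rewrite (linear_fsum _ _ _ (lin_oml d)).
by apply: eq_bigr => i _; rewrite (linear_fZ (lin_oml d)).
Qed.

Lemma form_sumr (I : Type) (r : seq I) (F : I -> D) (c : I -> K) d :
  omega d (\sum_(i <- r) c i *: F i) = \sum_(i <- r) c i * omega d (F i).
Proof.
rewrite (linear_fsum _ _ _ (lin_omr d)).
by apply: eq_bigr => i _; rewrite (linear_fZ (lin_omr d)).
Qed.

Lemma form_ext u w : (forall v, omega u v = omega w v) -> u = w.
Proof.
move=> uw; apply/eqP; rewrite -subr_eq0; apply/eqP/omega_nondeg => v.
by rewrite (linear_fB (lin_oml v)) uw subrr.
Qed.

(** The Gram matrix [G] of a basis is invertible: a row vector killed by [G] is the coordinate
    vector of an element orthogonal to all of [D]. The rows of its inverse are the coordinates of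
    the dual basis. *)
Lemma dual_bases_exist :
  exists e f : (\dim {:D}).-tuple D, dual_bases omega e f.
Proof.
pose e := vbasis {:D}; have eP : basis_of fullv e := vbasisP _.
pose G := \matrix_(i, j) omega e`_i e`_j : 'M[K]_(\dim {:D}).
have Gu : G \in unitmx.
  rewrite -row_free_unit; apply: inj_row_free => c cG0.
  have c0 : \sum_i c 0 i *: e`_i = 0.
    apply: omega_nondeg => d; rewrite (coord_vbasis (memvf d)) form_sumr.
    apply: big1 => j _; rewrite form_suml.
    have := congr1 (fun M : 'rV_ _ => M 0 j) cG0; rewrite !mxE => cj.
    suff -> : \sum_i c 0 i * omega e`_i e`_j = 0 by rewrite mulr0.
    by rewrite -[RHS]cj; apply: eq_bigr => i _; rewrite mxE.
  apply/rowP => i; rewrite mxE.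
  by have /freeP /(_ (c 0) c0) := basis_free eP.
exists e, [tuple \sum_k invmx G i k *: e`_k | i < \dim {:D}].
split=> // i j; rewrite tnth_mktuple form_suml (tnth_nth 0).
have := congr1 (fun M : 'M_ _ => M i j) (mulVmx Gu); rewrite !mxE => <-.
by apply: eq_bigr => k _; rewrite mxE.
Qed.

Variables (n : nat) (e f : n.-tuple D).
Hypothesis efP : dual_bases omega e f.

Let e_sum v : v = \sum_j coord e j v *: tnth e j.
Proof.
rewrite {1}(coord_basis efP.1 (memvf v)).
by apply: eq_bigr => j _; rewrite (tnth_nth 0).
Qed.

Lemma dual_bases_coord j v : omega (tnth f j) v = coord e j v.
Proof.
rewrite [in LHS](e_sum v) form_sumr (bigD1 j) //= efP.2 eqxx mulr1 big1 ?addr0 //.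
by move=> i; rewrite efP.2 eq_sym => /negPf ->; rewrite mulr0.
Qed.

Lemma dual_bases_sum_basis d : \sum_j omega (tnth f j) d *: tnth e j = d.
Proof.
by rewrite [RHS](e_sum d); apply: eq_bigr => j _; rewrite dual_bases_coord.
Qed.

Lemma dual_bases_sum_dual d : \sum_j omega d (tnth e j) *: tnth f j = d.
Proof.
apply: form_ext => v; rewrite form_suml [in RHS](e_sum v) form_sumr.
by apply: eq_bigr => j _; rewrite dual_bases_coord mulrC.
Qed.

Variable B : vectType K.

Definition contract (d : D) : tensor D B -> B :=
  tlift (fun d' b => omega d' d *: b).

Lemma linear_contract d : linear (contract d).
Proof. exact: linear_tlift. Qed.

Lemma contract_tens d d' b : contract d (d' ⊗ b) = omega d' d *: b.
Proof. by apply: tlift_tens; lin. Qed.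

(** Pairing on the right with [e] reads off coordinates along [f], so the expansion of the
    [D]-factor is in [f]. *)
Lemma contract_reconstruct a : a = \sum_j tnth f j ⊗ contract (tnth e j) a.
Proof.
move: a; apply: tensor_ext; first by lin.
  have := linear_contract; move=> lc; lin.
move=> d b; rewrite -{1}(dual_bases_sum_dual d).
rewrite (linear_fsum _ _ _ (linear_tensl _)); apply: eq_bigr => j _.
rewrite contract_tens (linear_fZ (linear_tensl _)).
by rewrite (linear_fZ (linear_tensr _)).
Qed.

End NondegenerateForm.

Lemma separating_contract (K : fieldType) (D B : vectType K)
    (omega : D -> D -> K) :
  bilinear_op (W := K^o) omega ->
  (forall d1, (forall d2, omega d1 d2 = 0) -> d1 = 0) ->
  separating (fun d => @contract K D omega B d).
Proof.
move=> bil nondeg; split; first by move=> d; apply: linear_contract.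
have [e [f efP]] := dual_bases_exist bil nondeg.
exists 'I_(\dim {:D}), (tnth e), (fun j b => tnth f j ⊗ b); split.
  by move=> j; lin.
exact: contract_reconstruct.
Qed.

(** * The induced ASI bialgebra *)

Section InducedAlgebra.
Variables (K : fieldType) (D B : vectType K).
Variables (dl dr : D -> D -> D) (omega : D -> D -> K) (dia : B -> B -> B).
Hypothesis quadP : quadratic_diassociative_algebra dl dr omega.
Hypothesis diaP : zinbiel_algebra dia.

Let diassP := quad_diass quadP.
Let skew := quad_skew quadP.
Let lin_oml y : linear (fun x => omega x y : K^o).
Proof. exact: (quad_bilinear quadP).1. Qed.
Let lin_omr x : linear (omega x : D -> K^o).
Proof. exact: (quad_bilinear quadP).2. Qed.
Let lin_dll y : linear (fun x => dl x y).
Proof. exact: (dl_bilinear diassP).1. Qed.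
Let lin_dlr x : linear (dl x).
Proof. exact: (dl_bilinear diassP).2. Qed.
Let lin_drl y : linear (fun x => dr x y).
Proof. exact: (dr_bilinear diassP).1. Qed.
Let lin_drr x : linear (dr x).
Proof. exact: (dr_bilinear diassP).2. Qed.
Let lin_dial y : linear (fun x => dia x y).
Proof. exact: (zinb_bilinear diaP).1. Qed.
Let lin_diar x : linear (dia x).
Proof. exact: (zinb_bilinear diaP).2. Qed.

Let omB x u v : omega x (u - v) = omega x u - omega x v.
Proof. exact: (linear_fB (lin_omr x)). Qed.

(* Every word of degree (1,1,1) in x, y, z, in this order, equals one of
   x |- (y |- z), x |- (y -| z) and x -| (y -| z). *)
Lemma dl_dr_collapse x y z : dl x (dr y z) = dl x (dl y z).
Proof. by rewrite -(dlldr diassP) (dl_assoc diassP). Qed.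

Lemma dr_dr_normal x y z : dr (dr x y) z = dr x (dr y z).
Proof. by rewrite (dr_assoc diassP). Qed.

Lemma dr_dl_normal x y z : dr (dl x y) z = dr x (dr y z).
Proof. by rewrite (dlrdr diassP) dr_dr_normal. Qed.

Lemma dl_dl_normal x y z : dl (dl x y) z = dl x (dl y z).
Proof. by rewrite (dl_assoc diassP). Qed.

Definition diass_normal := (dl_dr_collapse, dr_dr_normal, dr_dl_normal,
  dl_dl_normal, drldl diassP).

Lemma form_dr_l x y z : omega (dr x y) z = omega x (dr y z) - omega x (dl y z).
Proof. by rewrite (quad_dr quadP) omB. Qed.

Lemma form_dl_l x y z : omega (dl x y) z = omega x (dr y z).
Proof. exact: quad_dl quadP x y z. Qed.

Lemma form_dr_r x y z : omega x (dr y z) = - omega z (dl x y).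
Proof. by rewrite -form_dl_l skew. Qed.

Lemma form_dl_r x y z :
  omega x (dl y z) = omega z (dr x y) - omega z (dl x y).
Proof.
have -> : omega x (dl y z) = omega x (dr y z) - omega (dr x y) z.
  by rewrite form_dr_l; ring.
by rewrite form_dr_r (skew (dr x y)); ring.
Qed.

(* These move the last letter of a word into the other slot of the form, so that
   each axiom of the induced bialgebra becomes an identity whose coefficients are
   the values of the form at the three normal words. *)
Lemma rotate_drdr p x y z :
  omega p (dr x (dr y z)) = - omega z (dl p (dl x y)).
Proof. by rewrite -dr_dr_normal form_dr_r dl_dr_collapse. Qed.

Lemma rotate_drdl p x y z :
  omega p (dr x (dl y z)) =
  omega z (dr p (dr x y)) - omega z (dl p (dl x y)).
Proof. by rewrite -(drldl diassP) form_dl_r dl_dr_collapse. Qed.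

Lemma rotate_dldl p x y z :
  omega p (dl x (dl y z)) =
  omega z (dr p (dl x y)) - omega z (dl p (dl x y)).
Proof. by rewrite -dl_dl_normal form_dl_r. Qed.

Let mul := induced_mul dl dr dia.
Local Notation ctr := (contract omega (B := B)).
Local Notation ctr2 x y := (tmap (ctr x) (ctr y)).

Let lin_ctr d : linear (ctr d).
Proof. exact: linear_contract. Qed.

Lemma induced_mul_tens d1 b1 d2 b2 :
  mul (d1 ⊗ b1) (d2 ⊗ b2) = dr d1 d2 ⊗ dia b1 b2 + dl d1 d2 ⊗ dia b2 b1.
Proof. by rewrite /mul /induced_mul !tlift_tens //; lin. Qed.

Lemma induced_mul_bilinear : bilinear_op mul.
Proof. by rewrite /mul /induced_mul; lin. Qed.

Let lin_mull y : linear (fun x => mul x y).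
Proof. exact: induced_mul_bilinear.1. Qed.
Let lin_mulr x : linear (mul x).
Proof. exact: induced_mul_bilinear.2. Qed.

(** Invariance of [omega] moves [d] from the product to the contracting vector [x], which leaves
    only Zinbiel multiplication by [b]. *)
Lemma contract_mul_r x a d b :
  ctr x (mul a (d ⊗ b)) =
  dia (ctr (dr d x) a) b - dia (ctr (dl d x) a) b + dia b (ctr (dr d x) a).
Proof.
move: a; apply: tensor_ext; [by lin | by lin | move=> d' b'].
rewrite induced_mul_tens (linear_fD (lin_ctr _)) !contract_tens ?form_dr_l;
  try by lin.
rewrite form_dl_l !(linear_fZ (lin_dial _)) !(linear_fZ (lin_diar _)).
by rewrite scalerBl.
Qed.

(** Here skew-symmetry and the rotated forms of invariance are used, since [d] stands to the left of
    the contracted letter. *)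
Lemma contract_mul_l x a d b :
  ctr x (mul (d ⊗ b) a) =
  dia b (ctr (dl x d) a) + dia (ctr (dl x d) a) b - dia (ctr (dr x d) a) b.
Proof.
move: a; apply: tensor_ext; [by lin | by lin | move=> d' b'].
rewrite induced_mul_tens (linear_fD (lin_ctr _)) !contract_tens; try by lin.
have -> : omega (dr d d') x = omega d' (dl x d).
  by rewrite skew form_dr_r opprK.
have -> : omega (dl d d') x = omega d' (dl x d) - omega d' (dr x d).
  by rewrite skew form_dl_r opprB.
rewrite !(linear_fZ (lin_dial _)) !(linear_fZ (lin_diar _)).
by rewrite scalerBl addrA.
Qed.

Lemma contract2_mul_r_fst x y t d b :
  ctr2 x y (tmap (mul^~ (d ⊗ b)) id t) =
  tmap (dia^~ b) id (ctr2 (dr d x) y t) - tmap (dia^~ b) id (ctr2 (dl d x) y t)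
  + tmap (dia b) id (ctr2 (dr d x) y t).
Proof.
move: t; apply: tensor_ext; [by lin | by lin | move=> u v].
rewrite !tmap_tens; try by lin.
by rewrite contract_mul_r !tensDl tensNl.
Qed.

Lemma contract2_mul_r_snd x y t d b :
  ctr2 x y (tmap id (mul^~ (d ⊗ b)) t) =
  tmap id (dia^~ b) (ctr2 x (dr d y) t) - tmap id (dia^~ b) (ctr2 x (dl d y) t)
  + tmap id (dia b) (ctr2 x (dr d y) t).
Proof.
move: t; apply: tensor_ext; [by lin | by lin | move=> u v].
rewrite !tmap_tens; try by lin.
by rewrite contract_mul_r !tensDr tensNr.
Qed.

Lemma contract2_mul_l_fst x y t d b :
  ctr2 x y (tmap (mul (d ⊗ b)) id t) =
  tmap (dia b) id (ctr2 (dl x d) y t) + tmap (dia^~ b) id (ctr2 (dl x d) y t)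
  - tmap (dia^~ b) id (ctr2 (dr x d) y t).
Proof.
move: t; apply: tensor_ext; [by lin | by lin | move=> u v].
rewrite !tmap_tens; try by lin.
by rewrite contract_mul_l !tensDl tensNl.
Qed.

Lemma contract2_mul_l_snd x y t d b :
  ctr2 x y (tmap id (mul (d ⊗ b)) t) =
  tmap id (dia b) (ctr2 x (dl y d) t) + tmap id (dia^~ b) (ctr2 x (dl y d) t)
  - tmap id (dia^~ b) (ctr2 x (dr y d) t).
Proof.
move: t; apply: tensor_ext; [by lin | by lin | move=> u v].
rewrite !tmap_tens; try by lin.
by rewrite contract_mul_l !tensDr tensNr.
Qed.

Lemma contract2_tflip x y t : ctr2 x y (tflip t) = tflip (ctr2 y x t).
Proof. by rewrite tflip_tmap. Qed.

Lemma separating_contract1 : separating ctr.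
Proof.
apply: separating_contract; first exact: quad_bilinear quadP.
exact: quad_nondeg quadP.
Qed.

Lemma contract2_inj s t : (forall x y, ctr2 x y s = ctr2 x y t) -> s = t.
Proof.
move=> st; apply: (separating_inj (separating_tmap separating_contract1
  separating_contract1)) => -[x y]; exact: st.
Qed.

Lemma contract3_inj s t :
  (forall x y z, tmap (ctr x) (ctr2 y z) s = tmap (ctr x) (ctr2 y z) t) -> s = t.
Proof.
move=> st; apply: (separating_inj (separating_tmap separating_contract1
  (separating_tmap separating_contract1 separating_contract1))).
by move=> [x [y z]]; apply: st.
Qed.

Lemma induced_mul_assoc : associative mul.
Proof.
move=> a1 a2 a3.
(* The associator is linear in each argument, so it can be tested on pure tensors one variable at a
   time. *)
pose g a1 a2 a3 := mul a1 (mul a2 a3) - mul (mul a1 a2) a3.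
have lin1 u v : linear (fun a => g a u v).
  rewrite /g; apply: (@linear_fun_add _ _ _ (fun a => mul a (mul u v))
    (fun a => - mul (mul a u) v)); first by lin.
  apply: linear_fun_opp.
  by apply: (@linear_fun_comp _ _ _ _ (fun a => mul a u) (fun a => mul a v)).
have lin2 u v : linear (fun a => g u a v).
  rewrite /g; apply: (@linear_fun_add _ _ _ (fun a => mul u (mul a v))
    (fun a => - mul (mul u a) v)).
    by apply: (@linear_fun_comp _ _ _ _ (fun a => mul a v) (fun a => mul u a)).
  apply: linear_fun_opp.
  by apply: (@linear_fun_comp _ _ _ _ (fun a => mul u a) (fun a => mul a v)).
have lin3 u v : linear (fun a => g u v a).
  rewrite /g; apply: (@linear_fun_add _ _ _ (fun a => mul u (mul v a))
    (fun a => - mul (mul u v) a)).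
    by apply: (@linear_fun_comp _ _ _ _ (fun a => mul v a) (fun a => mul u a)).
  by apply: linear_fun_opp; lin.
suff g0 : g a1 a2 a3 = 0 by apply/eqP; rewrite -subr_eq0; apply/eqP.
move: a1; apply: (tensor_ext (h := fun=> 0)) => //; first exact: linear_fun_zero.
move=> d1 b1; move: a2.
apply: (tensor_ext (h := fun=> 0)) => //; first exact: linear_fun_zero.
move=> d2 b2; move: a3.
apply: (tensor_ext (h := fun=> 0)) => //; first exact: linear_fun_zero.
move=> d3 b3; rewrite /g !induced_mul_tens.
rewrite (linear_fD (lin_mulr _)) (linear_fD (lin_mull _)) !induced_mul_tens.
(* The [D]-factors become normal words and the [B]-factors become left-nested Zinbiel products; the
   remaining terms cancel. *)
rewrite !diass_normal !(zinb_axiom diaP) !tensDr.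
by apply/matrixP => i j; rewrite !mxE; ring.
Qed.

Variables (nu : B -> tensor B B) (thetal thetar : D -> tensor D D).
Hypothesis nuP : zinbiel_coalgebra nu.
Hypothesis thetalP : form_coproduct omega dl thetal.
Hypothesis thetarP : form_coproduct omega dr thetar.
Let Delta := induced_comul thetal thetar nu.

Let lin_nu : linear nu.
Proof. exact: zinb_colinear nuP. Qed.

Lemma form2_tens s x y :
  form2 omega s (x ⊗ y) = tlift (X := K^o) (fun a b => omega a x * omega b y) s.
Proof.
rewrite /form2; apply: (eq_tlift (X := K^o)) => a b.
apply: (tlift_tens (X := K^o)).
split=> [v | u] k w w' /=; rewrite lin_omr.
  by rewrite mulrDl; congr (_ + _); symmetry; apply: mulrA.
by rewrite mulrDr; congr (_ + _); apply: mulrCA.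
Qed.

Let bil_form2 x y :
  bilinear_op (W := K^o) (fun a b => omega a x * omega b y).
Proof.
split=> [v | u] k w w' /=; rewrite lin_oml.
  by rewrite mulrDl; congr (_ + _); symmetry; apply: mulrA.
by rewrite mulrDr; congr (_ + _); apply: mulrCA.
Qed.

Lemma contract2_bullet x y s (t : tensor B B) :
  ctr2 x y (tbullet s t) = form2 omega s (x ⊗ y) *: t.
Proof.
rewrite form2_tens; move: s; apply: tensor_ext.
- by rewrite /tbullet; lin.
- by apply: (@linear_fun_scalel _ _ _ (tlift (X := K^o) _) t); apply: linear_tlift.
move=> a b; rewrite (tlift_tens (X := K^o)) //.
rewrite /tbullet tlift_tens; last by lin.
move: t; apply: tensor_ext; [by lin | by lin | move=> u v].
rewrite tlift_tens; last by lin.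
by rewrite tmap_tens // !contract_tens // tensZl tensZr scalerA.
Qed.

(** The functionals [omega v x], viewed as maps to the line [K^o], are separating. Their tensor
    products are separating too, and take the value [form2] times [1 ⊗ 1]. *)
Lemma form2_inj s t :
  (forall x y, form2 omega s (x ⊗ y) = form2 omega t (x ⊗ y)) -> s = t.
Proof.
move=> st; pose phi x (v : D) : K^o := omega v x.
have sep : separating phi.
  split; first by move=> x; apply: lin_oml.
  have [e [f efP]] := dual_bases_exist (quad_bilinear quadP) (quad_nondeg quadP).
  exists 'I_(\dim {:D}), (tnth e), (fun j c => (c : K) *: tnth f j); split.
    by move=> j k u v; rewrite scalerDl -scalerA.
  move=> v; symmetry.
  by apply: dual_bases_sum_dual efP v; case: quadP.
have phi2 x y u :
    tmap (phi x) (phi y) u =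
    form2 omega u (x ⊗ y) *: ((1 : K^o) ⊗ (1 : K^o)).
  rewrite form2_tens; move: u; apply: tensor_ext.
  - by lin.
  - by apply: (@linear_fun_scalel _ _ _ (tlift (X := K^o) _)); apply: linear_tlift.
  move=> a b; rewrite (tlift_tens (X := K^o)) // tmap_tens; try exact: lin_oml.
  rewrite -scalerA -tensZr -tensZl; congr (_ ⊗ _).
    by rewrite /phi /GRing.scale /= mulr1.
  by rewrite /phi /GRing.scale /= mulr1.
apply: (separating_inj (separating_tmap sep sep)) => -[x y] /=.
by rewrite !phi2 st.
Qed.

Let form2_lin x y : linear (fun s => form2 omega s (x ⊗ y) : K^o).
Proof. by move=> k s t; rewrite !form2_tens linearP. Qed.

(** The map [theta] is known only through its pairings, which are linear in its argument;
    nondegeneracy transfers this to [theta]. *)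
Lemma form_coproduct_linear op theta :
  form_coproduct omega op theta -> linear theta.
Proof.
move=> thetaP k u v; apply: form2_inj => x y.
by rewrite form2_lin !thetaP lin_oml.
Qed.

Let lin_thetal : linear thetal := form_coproduct_linear thetalP.
Let lin_thetar : linear thetar := form_coproduct_linear thetarP.

Let lin_bulletl (t : tensor B B) : linear (fun s : tensor D D => tbullet s t).
Proof. exact: linear_tlift. Qed.

Let lin_bulletr (s : tensor D D) : linear (fun t : tensor B B => tbullet s t).
Proof. by rewrite /tbullet; lin. Qed.

Let lin_Delta : linear Delta.
Proof. exact: linear_tlift. Qed.

Lemma contract2_comul_tens x y d b :
  ctr2 x y (Delta (d ⊗ b)) =
  omega d (dr x y) *: nu b + omega d (dl x y) *: tflip (nu b).
Proof.
rewrite /Delta /induced_comul tlift_tens; last by lin.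
by rewrite linearD /= !contract2_bullet thetalP thetarP.
Qed.

Lemma contract2_comul x y a :
  ctr2 x y (Delta a) = nu (ctr (dr x y) a) + tflip (nu (ctr (dl x y) a)).
Proof.
move: a; apply: tensor_ext; [by lin | by lin | move=> d b].
rewrite contract2_comul_tens !contract_tens // !(linear_fZ lin_nu).
by rewrite linearZ.
Qed.

Lemma contract3_comul_snd x y z t :
  tmap (ctr x) (ctr2 y z) (tmap id Delta t) =
  tmap id nu (ctr2 x (dr y z) t)
  + tmap id (fun b => tflip (nu b)) (ctr2 x (dl y z) t).
Proof.
have lin_tnu : linear (fun b => tflip (nu b)) by lin.
move: t; apply: tensor_ext; [by lin | by lin | move=> u v].
by rewrite !tmap_tens ?contract2_comul ?tensDr //; lin.
Qed.

Lemma contract3_comul_fst x y z t :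
  tmap (ctr x) (ctr2 y z) (tassoc (tmap Delta id t)) =
  tassoc (tmap nu id (ctr2 (dr x y) z t))
  + tassoc (tmap (fun b => tflip (nu b)) id (ctr2 (dl x y) z t)).
Proof.
have lin_tnu : linear (fun b => tflip (nu b)) by lin.
rewrite tassoc_tmap_tens // -linearD /=; congr tassoc.
move: t; apply: tensor_ext; [by lin | by lin | move=> u v].
by rewrite !tmap_tens ?contract2_comul ?tensDl //; lin.
Qed.

(** After contraction, the coefficient of [omega d] at [x |- y |- z] is the coalgebra axiom, at
    [x |- y -| z] it is [zinbiel_coalgebra_swap_last], and at [x -| y -| z] it is
    [zinbiel_coalgebra_reverse]. *)
Lemma induced_comul_coassoc a :
  tmap id Delta (Delta a) = tassoc (tmap Delta id (Delta a)).
Proof.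
move: a; apply: tensor_ext; [by lin | by lin | move=> d b].
apply: contract3_inj => x y z.
rewrite contract3_comul_snd contract3_comul_fst !contract2_comul_tens.
rewrite !diass_normal !tmapD !tmapZ !tassocD !tassocZ -!zinbiel_coalgebra_swap_last //.
rewrite -!zinbiel_coalgebra_reverse //.
rewrite (zinb_coaxiom nuP) -(@tmap_comp K _ _ _ _ _ _ nu id (@tflip K B B) id);
  try by lin.
by apply/matrixP => i j; rewrite !mxE; ring.
Qed.

Hypothesis bialgP : zinbiel_bialgebra dia nu.

(** Together with [compat1_flip] and [compat2], this eliminates [nu (dia b2 b1)] and the flips of
    both coproducts in favour of [nu (dia b1 b2)]. *)
Let compat1 b1 b2 : nu (dia b2 b1) =
  tmap id (dia b1) (nu b2) + tmap id (dia^~ b1) (nu b2)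
  + tmap (dia b2) id (nu b1) - nu (dia b1 b2).
Proof.
by rewrite -tmapDr -(zinb_compat1 bialgP) addrK.
Qed.

Let flip_tmap (f g : B -> B) t :
  linear f -> linear g -> tflip (tmap f g t) = tmap g f (tflip t).
Proof. exact: tflip_tmap. Qed.

Let compat1_flip b1 b2 : tflip (nu (dia b2 b1)) =
  tmap (dia b2) id (tflip (nu b1)) + tmap (dia^~ b2) id (tflip (nu b1))
  + tmap id (dia b1) (tflip (nu b2)) - tflip (nu (dia b1 b2)).
Proof.
rewrite (compat1 b2 b1) !(tflipD, tflipN) !flip_tmap //.
by rewrite opprB addrC subrK.
Qed.

Let compat2 b1 b2 : tflip (nu (dia b1 b2)) =
  tmap (dia^~ b2) id (tflip (nu b1)) + tmap id (dia b1) (tflip (nu b2))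
  + tmap id (dia b1) (nu b2) - nu (dia b1 b2).
Proof.
have := congr1 (@tflip K B B) (zinb_compat2 bialgP b1 b2).
rewrite !(tflipD, tmapD) !flip_tmap // !tflipK addrA => <-.
by rewrite addrK.
Qed.

Lemma induced_compat1 a1 a2 :
  Delta (mul a1 a2) =
  tmap (mul^~ a2) id (Delta a1) + tmap id (mul a1) (Delta a2).
Proof.
move: a1; apply: tensor_ext; first by lin.
  by rewrite /tmap; lin.
move=> d1 b1; move: a2; apply: tensor_ext; first by lin.
  by rewrite /tmap; lin.
move=> d2 b2; apply: contract2_inj => x y.
rewrite induced_mul_tens tmapD contract2_mul_r_fst contract2_mul_l_snd.
rewrite (linear_fD lin_Delta) tmapD !contract2_comul_tens.
(* After the rotation every coefficient is a value of [omega d1] at a normal word in [d2], [x],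
   [y]. *)
rewrite !form_dr_l !form_dl_l !diass_normal (rotate_drdr d2) (rotate_drdl d2)
  (rotate_dldl d2).
rewrite (compat1_flip b1 b2) (compat1 b1 b2) (compat2 b1 b2) !(tmapD, tmapZ).
by apply/matrixP => i j; rewrite !mxE; ring.
Qed.

Lemma induced_compat2 a1 a2 :
  tmap (mul a1) id (Delta a2) - tmap id (mul^~ a1) (Delta a2) =
  tflip (tmap id (mul^~ a2) (Delta a1) - tmap (mul a2) id (Delta a1)).
Proof.
move: a1; apply: tensor_ext; first by rewrite /tmap; lin.
  by rewrite /tmap; lin.
move=> d1 b1; move: a2; apply: tensor_ext; first by rewrite /tmap; lin.
  by rewrite /tmap; lin.
move=> d2 b2; apply: contract2_inj => x y.
rewrite contract2_tflip !(tmapD, tmapN) !contract2_mul_r_snd !contract2_mul_l_fst.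
rewrite !contract2_comul_tens !diass_normal.
(* The right-hand side has [omega d1] at words in [y], [d2], [x]. Two successive rotations turn
   these into [omega d2] at words in [x], [d1], [y], as on the left. *)
rewrite (rotate_drdr d1) (rotate_drdl d1) (rotate_dldl d1).
rewrite (rotate_drdr x) (rotate_drdl x) (rotate_dldl x).
(* The left-hand side of the first compatibility is symmetric in [b1] and [b2], so its two
   right-hand sides agree. *)
have sym : tmap (dia b1) id (nu b2) =
    tmap id (dia b1) (nu b2) + tmap id (dia^~ b1) (nu b2)
    + tmap (dia b2) id (nu b1) - tmap id (dia b2) (nu b1)
    - tmap id (dia^~ b2) (nu b1).
  have := zinb_compat1 bialgP b2 b1; rewrite addrC (zinb_compat1 bialgP b1 b2).
  rewrite !tmapDr => <-.
  by rewrite -addrA -opprD addrC addKr.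
have sym_flip := congr1 (@tflip K B B) sym.
rewrite !(tflipD, tflipN) !flip_tmap // in sym_flip.
(* The left-hand side of the second compatibility is fixed by the flip, so its right-hand side
   equals its own flip. *)
have sym2 : tmap (dia^~ b1) id (tflip (nu b2)) =
    tmap id (dia^~ b1) (nu b2) + tmap (dia b2) id (nu b1)
    + tmap (dia b2) id (tflip (nu b1))
    - tmap id (dia b2) (nu b1) - tmap id (dia b2) (tflip (nu b1)).
  have := zinb_compat2 bialgP b2 b1.
  rewrite compat2 (addrC (nu _)) subrK tmapD !addrA => <-.
  by rewrite addrK addrK.
rewrite !(tmapD, tmapZ) !(tflipD, tflipN, tflipZ) !flip_tmap // !tflipK.
rewrite sym_flip sym sym2.
by apply/matrixP=> i j; rewrite !mxE; ring.
Qed.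

Lemma induced_asi_bialgebra : asi_bialgebra mul Delta.
Proof.
split; [exact: induced_mul_bilinear | exact: induced_mul_assoc | by []
  | exact: induced_comul_coassoc | exact: induced_compat1
  | exact: induced_compat2].
Qed.

End InducedAlgebra.

(** * Double sums over two copies of a tensor *)

Section DoubleLift.
Variables (K : fieldType) (B : vectType K) (r : tensor B B).
Implicit Types X Y : lmodType K.

(* For r = sum_i x_i ⊗ y_i this is sum_i sum_j G x_i y_i x_j y_j. *)
Definition tlift2 X (G : B -> B -> B -> B -> X) : X :=
  tlift (fun a b => tlift (fun c d => G a b c d) r) r.

Lemma eq_tlift2 X (G H : B -> B -> B -> B -> X) :
  (forall a b c d, G a b c d = H a b c d) -> tlift2 G = tlift2 H.
Proof. by move=> GH; do 2!apply: eq_tlift => ? ?; apply: GH. Qed.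

Lemma tliftDf X (f g : B -> B -> X) t :
  tlift (fun x y => f x y + g x y) t = tlift f t + tlift g t.
Proof.
rewrite /tlift -big_split; apply: eq_bigr => i _ /=.
by rewrite -big_split; apply: eq_bigr => j _ /=; rewrite scalerDr.
Qed.

Lemma tliftZf X a (f : B -> B -> X) t :
  tlift (fun x y => a *: f x y) t = a *: tlift f t.
Proof. by rewrite (comp_tlift (h := fun x => a *: x)) //; lin. Qed.

Lemma tlift2D X (G H : B -> B -> B -> B -> X) :
  tlift2 (fun a b c d => G a b c d + H a b c d) = tlift2 G + tlift2 H.
Proof. by rewrite /tlift2 -tliftDf; apply: eq_tlift => a b; rewrite tliftDf. Qed.

Lemma tlift2Z X k (G : B -> B -> B -> B -> X) :
  tlift2 (fun a b c d => k *: G a b c d) = k *: tlift2 G.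
Proof. by rewrite /tlift2 -tliftZf; apply: eq_tlift => a b; rewrite tliftZf. Qed.

Lemma tlift2N X (G : B -> B -> B -> B -> X) :
  tlift2 (fun a b c d => - G a b c d) = - tlift2 G.
Proof.
by rewrite -scaleN1r -tlift2Z; apply: eq_tlift2 => a b c d; rewrite scaleN1r.
Qed.

Lemma comp_tlift2 X Y (h : X -> Y) (G : B -> B -> B -> B -> X) :
  linear h -> h (tlift2 G) = tlift2 (fun a b c d => h (G a b c d)).
Proof.
by move=> lh; rewrite /tlift2 comp_tlift //; apply: eq_tlift => a b;
  rewrite comp_tlift.
Qed.

Lemma tlift2_swap X (G : B -> B -> B -> B -> X) :
  tlift2 G = tlift2 (fun a b c d => G c d a b).
Proof.
have tliftE (f : B -> B -> X) t : tlift f t = \sum_p t p.1 p.2 *: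
    f (vbasis {:B})`_p.1 (vbasis {:B})`_p.2 by rewrite /tlift pair_bigA.
rewrite /tlift2 !tliftE.
under eq_bigr => p _ do rewrite tliftE scaler_sumr.
under [in RHS]eq_bigr => p _ do rewrite tliftE scaler_sumr.
rewrite exchange_big; apply: eq_bigr => p _; apply: eq_bigr => q _.
by rewrite !scalerA mulrC.
Qed.

End DoubleLift.

(** The two identities drawn from the ZYBE each arise as a difference of two vanishing sums. *)
Lemma eq_of_sub_eq0 (V : zmodType) (p q x y : V) :
  p = 0 -> q = 0 -> x - y = p - q -> x = y.
Proof. by move=> -> ->; rewrite subrr => /eqP; rewrite subr_eq0 => /eqP. Qed.

(** * Invariance and the Zinbiel Yang-Baxter equation *)

Section ZinbielInvariance.
Variables (K : fieldType) (B : vectType K) (dia : B -> B -> B).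
Hypothesis diaP : zinbiel_algebra dia.

Let lin_dial y : linear (fun x => dia x y).
Proof. exact: (zinb_bilinear diaP).1. Qed.
Let lin_diar x : linear (dia x).
Proof. exact: (zinb_bilinear diaP).2. Qed.

Lemma zinb_coboundE (s : tensor B B) b :
  zinb_cobound dia s b =
  tmap (dia b) id s - tmap id (dia b) s - tmap id (dia^~ b) s.
Proof. by rewrite /zinb_cobound tmapDr opprD addrA. Qed.

Lemma zinb_coboundD s t b :
  zinb_cobound dia (s + t) b = zinb_cobound dia s b + zinb_cobound dia t b.
Proof. by rewrite /zinb_cobound !tmapD opprD addrACA. Qed.

Variable r : tensor B B.
Hypothesis r_inv : zinb_invariant dia (r - tflip r).

(** The flipped invariance condition is solved for one term, so that it can serve as an elimination
    rule. *)
Lemma zinb_invariant_flip b :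
  tmap id (dia b) (tflip r) =
  tmap (dia b) id (tflip r) + tmap (dia^~ b) id (tflip r) + tmap id (dia b) r
  - tmap (dia b) id r - tmap (dia^~ b) id r.
Proof.
have := congr1 (@tflip K B B) (r_inv b).
rewrite zinb_coboundE !(tmapD, tmapN) !(tflipD, tflipN) !(tflip_tmap (K := K)) //.
rewrite !tflipK (linear_f0 (@linear_tflip K B B)) => /matrixP H.
apply/matrixP => i j; apply/eqP; rewrite -subr_eq0; apply/eqP.
by have := H i j; rewrite !mxE => <-; ring.
Qed.

(** Keeping the tensor [t] as a variable makes this linear in [t], so it can be computed on pure
    tensors before being evaluated at [r], where it vanishes. *)
Let flip_defect b t : tensor B B :=
  tmap (dia b) id (tflip t) + tmap (dia^~ b) id (tflip t) + tmap id (dia b) t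
  - tmap (dia b) id t - tmap (dia^~ b) id t - tmap id (dia b) (tflip t).

Let flip_defect0 b : flip_defect b r = 0.
Proof. by rewrite /flip_defect zinb_invariant_flip subrr. Qed.

Let lin_defect b : linear (flip_defect b).
Proof. by rewrite /flip_defect; lin. Qed.

Let lin_id : linear (@id B). Proof. by []. Qed.

Let flip_defect_tens b c d : flip_defect b (c ⊗ d) =
  dia b d ⊗ c + dia d b ⊗ c + c ⊗ dia b d
  - dia b c ⊗ d - dia c b ⊗ d - d ⊗ dia b c.
Proof. by rewrite /flip_defect tflip_tens !tmap_tens. Qed.

(** For each pure term of the outer copy of [r], the inner sum is the defect of [xi] at [r], with
    [yi] appended as third factor. *)
Let invariance_fst :
  tlift2 r (fun xi yi xj yj => dia xi yj ⊗ xj ⊗ yi + dia yj xi ⊗ xj ⊗ yi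
    + xj ⊗ dia xi yj ⊗ yi - dia xi xj ⊗ yj ⊗ yi - dia xj xi ⊗ yj ⊗ yi
    - yj ⊗ dia xi xj ⊗ yi) = 0.
Proof.
suff E (b y : B) t : tlift (fun c d => dia b d ⊗ c ⊗ y + dia d b ⊗ c ⊗ y
    + c ⊗ dia b d ⊗ y - dia b c ⊗ d ⊗ y - dia c b ⊗ d ⊗ y - d ⊗ dia b c ⊗ y) t
    = tassoc (flip_defect b t ⊗ y).
  rewrite /tlift2 (eq_tlift (g := fun _ _ => 0)).
    by rewrite /tlift big1 // => i _; rewrite big1 // => j _; rewrite scaler0.
  move=> x y; rewrite E flip_defect0 (linear_f0 (linear_tensl _)).
  exact: linear_f0 (@linear_tassoc _ _ _ _).
move: t; apply: tensor_ext; [by lin | by lin | move=> c d].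
rewrite tlift_tens; last by lin.
by rewrite flip_defect_tens !(tensDl, tensNl) !(linearD, linearN) /= !tassoc_tens.
Qed.

(** Here the inner sum is the defect of [yi] at [r], with [xi] put in front as first factor. *)
Let invariance_snd :
  tlift2 r (fun xi yi xj yj => xi ⊗ dia yi yj ⊗ xj + xi ⊗ dia yj yi ⊗ xj
    + xi ⊗ xj ⊗ dia yi yj - xi ⊗ dia yi xj ⊗ yj - xi ⊗ dia xj yi ⊗ yj
    - xi ⊗ yj ⊗ dia yi xj) = 0.
Proof.
suff E (b x : B) t : tlift (fun c d => x ⊗ dia b d ⊗ c + x ⊗ dia d b ⊗ c
    + x ⊗ c ⊗ dia b d - x ⊗ dia b c ⊗ d - x ⊗ dia c b ⊗ d - x ⊗ d ⊗ dia b c) t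
    = x ⊗ flip_defect b t.
  rewrite /tlift2 (eq_tlift (g := fun _ _ => 0)).
    by rewrite /tlift big1 // => i _; rewrite big1 // => j _; rewrite scaler0.
  move=> x y; rewrite E flip_defect0.
  exact: linear_f0 (linear_tensr _).
move: t; apply: tensor_ext; [by lin | by lin | move=> c d].
rewrite tlift_tens; last by lin.
by rewrite flip_defect_tens !(tensDr, tensNr).
Qed.

Hypothesis r_zybe : zybe dia r.

(* Up to exchanging i and j, invariance trades five of the eight terms of the
   ZYBE for the left-hand side below. *)
Lemma zybe_fst :
  tlift2 r (fun xi yi xj yj => dia xi xj ⊗ yi ⊗ yj) =
  tlift2 r (fun xi yi xj yj => xi ⊗ xj ⊗ dia yi yj)
  + tlift2 r (fun xi yi xj yj => xi ⊗ xj ⊗ dia yj yi)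
  - tlift2 r (fun xi yi xj yj => xj ⊗ dia yj xi ⊗ yi).
Proof.
have Z := r_zybe; rewrite /zybe -/(tlift2 r _) in Z.
have I := invariance_fst.
rewrite !(tlift2D, tlift2N) in Z I.
have sw1 := tlift2_swap r (fun a b c d => dia b c ⊗ a ⊗ d).
have sw2 := tlift2_swap r (fun a b c d => a ⊗ dia b c ⊗ d).
have sw3 := tlift2_swap r (fun a b c d => c ⊗ a ⊗ dia b d).
have sw4 := tlift2_swap r (fun a b c d => dia c a ⊗ d ⊗ b).
rewrite sw1 sw2 sw3 in Z; rewrite sw4 in I.
apply: (eq_of_sub_eq0 Z I); apply/matrixP => i j; rewrite !mxE; ring.
Qed.

(* This is zybe_fst with its last two factors exchanged, corrected by
   invariance. *)
Lemma zybe_snd :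
  tlift2 r (fun xi yi xj yj => dia xj xi ⊗ yi ⊗ yj) =
  tlift2 r (fun xi yi xj yj => xj ⊗ dia xi yj ⊗ yi)
  + tlift2 r (fun xi yi xj yj => xj ⊗ dia yj xi ⊗ yi)
  - tlift2 r (fun xi yi xj yj => xi ⊗ xj ⊗ dia yi yj).
Proof.
have lin_P : linear (tmap (@id B) (@tflip K B B)) by lin.
have P_tens (x y z : B) : tmap id (@tflip K B B) (x ⊗ y ⊗ z) = x ⊗ z ⊗ y.
  by rewrite tmap_tens ?tflip_tens //; lin.
have Z := congr1 (tmap (@id B) (@tflip K B B)) zybe_fst.
rewrite !(tmapD, tmapN) !(comp_tlift2 _ _ lin_P) in Z.
rewrite !(eq_tlift2 _ (fun _ _ _ _ => P_tens _ _ _)) in Z.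
have I := invariance_snd; rewrite !(tlift2D, tlift2N) in I.
have sw1 := tlift2_swap r (fun a b c d => a ⊗ dia b c ⊗ d).
have sw2 := tlift2_swap r (fun a b c d => a ⊗ dia c b ⊗ d).
have sw3 := tlift2_swap r (fun a b c d => dia a c ⊗ d ⊗ b).
have sw4 := tlift2_swap r (fun a b c d => c ⊗ b ⊗ dia d a).
rewrite sw3 sw4 in Z; rewrite sw1 sw2 in I.
move/esym/eqP: Z; rewrite -subr_eq0 => /eqP Z.
apply: (eq_of_sub_eq0 I Z); apply/matrixP => i j; rewrite !mxE; ring.
Qed.

End ZinbielInvariance.

Lemma linear_lfunE (K : fieldType) (V W : vectType K) (g : V -> W) :
  linear g -> linfun g =1 g.
Proof.
move=> lg; pose G := GRing.isLinear.Build K V W _ g lg.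
pose h : {linear V -> W} := HB.pack g G.
exact: (lfunE h).
Qed.

(** * The tensor induced by a solution of the ZYBE *)

Section InducedTensor.
Variables (K : fieldType) (D B : vectType K).
Variables (dl dr : D -> D -> D) (omega : D -> D -> K) (dia : B -> B -> B).
Hypothesis quadP : quadratic_diassociative_algebra dl dr omega.
Hypothesis diaP : zinbiel_algebra dia.
Variables (n : nat) (e f : n.-tuple D).
Hypothesis efP : dual_bases omega e f.

Let skew := quad_skew quadP.
Let omega_bil := quad_bilinear quadP.
Let omega_nondeg := quad_nondeg quadP.
Let lin_dial y : linear (fun x => dia x y).
Proof. exact: (zinb_bilinear diaP).1. Qed.
Let lin_diar x : linear (dia x).
Proof. exact: (zinb_bilinear diaP).2. Qed.

Local Notation A := (tensor D B).
Let mul : A -> A -> A := induced_mul dl dr dia.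
Let lin_mull y : linear (fun x => mul x y).
Proof. exact: (induced_mul_bilinear dl dr dia).1. Qed.
Let lin_mulr x : linear (mul x).
Proof. exact: (induced_mul_bilinear dl dr dia).2. Qed.

Local Notation ctr := (contract omega (B := B)).
Local Notation ctr2 x y := (tmap (ctr x) (ctr y)).
Local Notation hat := (induced_r e f (B := B)).

Let lin_ctr d : linear (ctr d).
Proof. exact: linear_contract. Qed.
Let ctr_tens d d' b : ctr d (d' ⊗ b) = omega d' d *: b.
Proof. exact: contract_tens. Qed.

Lemma linear_induced_r : linear hat.
Proof. by rewrite /induced_r; lin. Qed.
Let lin_hat := linear_induced_r.

Lemma induced_r_tens x y :
  hat (x ⊗ y) = \sum_j (tnth e j ⊗ x) ⊗ (tnth f j ⊗ y).
Proof.
by rewrite /induced_r; apply: eq_bigr => j _; rewrite tlift_tens //; lin.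
Qed.

(** Contracting the leg that carries [f] against [z] collapses the sum over the dual bases, because
    the sum of [omega f_j z *: e_j] is [z]. *)
Lemma tlift_contract_snd (X : lmodType K) (F : A -> B -> X) z r :
  bilinear_op F ->
  tlift (fun u v => F u (ctr z v)) (hat r) = tlift (fun x y => F (z ⊗ x) y) r.
Proof.
move=> [Fl Fr]; move: r; apply: tensor_ext; [by lin | by lin | move=> x y].
rewrite induced_r_tens linear_sum /= [RHS]tlift_tens; last by lin.
rewrite -[in RHS](dual_bases_sum_basis omega_bil efP z).
rewrite (linear_fsum _ _ _ (linear_tensl _)) (linear_fsum _ _ _ (Fl _)).
apply: eq_bigr => j _; rewrite tlift_tens; last by lin.
by rewrite ctr_tens (linear_fZ (Fr _)) tensZl (linear_fZ (Fl _)).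
Qed.

(** The sum over [j] now collapses through the expansion of [z] along [f]; the sign comes from
    writing [omega e_j z] as [- omega z e_j]. *)
Lemma tlift_contract_fst (X : lmodType K) (F : B -> A -> X) z r :
  bilinear_op F ->
  tlift (fun u v => F (ctr z u) v) (hat r) =
  - tlift (fun x y => F x (z ⊗ y)) r.
Proof.
move=> [Fl Fr]; move: r; apply: tensor_ext; [by lin | by lin | move=> x y].
rewrite induced_r_tens linear_sum /= [in RHS]tlift_tens; last by lin.
rewrite -[in RHS](dual_bases_sum_dual omega_bil omega_nondeg efP z).
rewrite (linear_fsum _ _ _ (linear_tensl _)) (linear_fsum _ _ _ (Fr _)).
rewrite -sumrN; apply: eq_bigr => j _; rewrite tlift_tens; last by lin.
rewrite ctr_tens (linear_fZ (Fl _)) tensZl (linear_fZ (Fr _)).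
by rewrite (skew z) scaleNr opprK.
Qed.

Lemma contract2_induced_r x y r : ctr2 x y (hat r) = omega y x *: r.
Proof.
rewrite /tmap (tlift_contract_snd (F := fun u w => ctr x u ⊗ w)); last by lin.
move: r; apply: tensor_ext; [by lin | by lin | move=> a b].
rewrite tlift_tens; last by lin.
by rewrite ctr_tens tensZl.
Qed.

(** Skew-symmetry of [omega] produces the sign. This is how [r - tau(r)] on [B] corresponds to the
    sum of the induced tensor and its flip. *)
Lemma induced_r_flip r : tflip (hat r) = - hat (tflip r).
Proof.
apply: (contract2_inj quadP) => x y; rewrite contract2_tflip tmapN.
by rewrite !contract2_induced_r tflipZ skew scaleNr.
Qed.

Let hatB s t : hat (s - t) = hat s - hat t.
Proof. exact: linear_fB lin_hat s t. Qed.

(** The coefficient of [omega d (dr x y)] is the coboundary itself. That of [omega d (dl x y)] is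
    the flipped coboundary formula with [r] in place of [tau(r)], and invariance of [r - tau(r)]
    identifies the two. *)
Lemma contract2_induced_cobound r x y d b :
  zinb_invariant dia (r - tflip r) ->
  ctr2 x y (asi_cobound mul (hat r) (d ⊗ b)) =
  omega d (dr x y) *: zinb_cobound dia r b
  + omega d (dl x y) *: tflip (zinb_cobound dia r b).
Proof.
move=> r_inv; rewrite /asi_cobound tmapD tmapN.
rewrite (contract2_mul_l_snd quadP) // (contract2_mul_r_fst quadP) //.
rewrite !contract2_induced_r !tmapZ.
have -> : omega (dl y d) x = omega d (dl x y) - omega d (dr x y).
  by rewrite skew (form_dl_r quadP) opprB.
have -> : omega (dr y d) x = omega d (dl x y).
  by rewrite skew (form_dr_r quadP) opprK.
have -> : omega y (dr d x) = omega d (dl x y) - omega d (dr x y).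
  by rewrite skew (form_dr_l quadP) opprB.
have -> : omega y (dl d x) = - omega d (dr x y).
  by rewrite skew (form_dl_l quadP).
rewrite !zinb_coboundE // !(tflipD, tflipN) !(tflip_tmap (K := K)) //.
rewrite (zinb_invariant_flip diaP r_inv).
by apply/matrixP => i j; rewrite !mxE; ring.
Qed.

Lemma induced_cobound_comul (nu : B -> tensor B B)
    (thetal thetar : D -> tensor D D) r :
  zinbiel_coalgebra nu ->
  form_coproduct omega dl thetal -> form_coproduct omega dr thetar ->
  zinb_invariant dia (r - tflip r) -> nu =1 zinb_cobound dia r ->
  induced_comul thetal thetar nu =1 asi_cobound mul (hat r).
Proof.
move=> nuP tlP trP r_inv nuE; apply: tensor_ext; first exact: linear_tlift.
  by rewrite /asi_cobound /tmap; lin.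
move=> d b; apply: (contract2_inj quadP) => x y.
by rewrite (contract2_comul_tens quadP) // contract2_induced_cobound // nuE.
Qed.

Lemma induced_r_invariant s :
  zinb_invariant dia s -> zinb_invariant dia (s - tflip s) ->
  ass_invariant mul (hat s).
Proof.
move=> s_inv s_inv'; apply: (tensor_ext (h := fun=> 0)).
- by rewrite /asi_cobound /tmap; lin.
- exact: linear_fun_zero.
move=> d b; apply: (contract2_inj quadP) => x y.
rewrite contract2_induced_cobound // s_inv (linear_f0 (@linear_tflip K B B)).
by rewrite !scaler0 addr0 (linear_f0 (linear_tmap _ _)).
Qed.

Lemma induced_r_sum_flip_invariant r :
  zinb_invariant dia (r - tflip r) -> ass_invariant mul (hat r + tflip (hat r)).
Proof.
move=> r_inv; rewrite induced_r_flip -hatB; apply: induced_r_invariant => // b.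
(* For [s = r - tau(r)] the difference [s - tau(s)] is [s + s], hence invariant as well. *)
rewrite tflipD tflipN tflipK -[_ - r]opprB opprK.
by rewrite zinb_coboundD r_inv addr0.
Qed.

Let ctr_mul_tens x d1 b1 d2 b2 : ctr x (mul (d1 ⊗ b1) (d2 ⊗ b2)) =
  omega (dr d1 d2) x *: dia b1 b2 + omega (dl d1 d2) x *: dia b2 b1.
Proof.
by rewrite /mul (induced_mul_tens quadP diaP) (linear_fD (lin_ctr x)) !ctr_tens.
Qed.

(** In each AYBE term two of the three contractions meet a bare leg and put the contracting vector
    into the partner leg. Contracting a first leg costs a sign, so the three terms carry none, two
    and one. *)
Let aybe_term1 x y z r :
  tlift2 (hat r) (fun ui vi uj vj => ctr x (mul ui uj) ⊗ ctr y vi ⊗ ctr z vj) =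
  omega (dr y z) x *: tlift2 r (fun xi yi xj yj => dia xi xj ⊗ yi ⊗ yj)
  + omega (dl y z) x *: tlift2 r (fun xi yi xj yj => dia xj xi ⊗ yi ⊗ yj).
Proof.
rewrite /tlift2; under eq_tlift => u v.
  rewrite (tlift_contract_snd
    (F := fun u' w => ctr x (mul u u') ⊗ ctr y v ⊗ w)); last by lin.
  over.
rewrite (tlift_contract_snd (F := fun u w =>
  tlift (fun a b => ctr x (mul u (z ⊗ a)) ⊗ w ⊗ b) r)); last by lin.
rewrite -!/(tlift2 r _) -!tlift2Z -tlift2D; apply: eq_tlift2 => a b c d.
by rewrite ctr_mul_tens tensDl !tensZl.
Qed.

Let aybe_term2 x y z r :
  tlift2 (hat r) (fun ui vi uj vj => ctr x ui ⊗ ctr y uj ⊗ ctr z (mul vi vj)) =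
  omega (dr x y) z *: tlift2 r (fun xi yi xj yj => xi ⊗ xj ⊗ dia yi yj)
  + omega (dl x y) z *: tlift2 r (fun xi yi xj yj => xi ⊗ xj ⊗ dia yj yi).
Proof.
rewrite /tlift2; under eq_tlift => u v.
  rewrite (tlift_contract_fst
    (F := fun w v' => ctr x u ⊗ w ⊗ ctr z (mul v v'))); last by lin.
  over.
rewrite (tlift_contract_fst (F := fun w v =>
  - tlift (fun a b => w ⊗ a ⊗ ctr z (mul v (y ⊗ b))) r)); last by lin.
rewrite -!/(tlift2 r _) -!tlift2Z -tlift2D /tlift2.
rewrite -(comp_tlift (h := fun t => - t)) ?opprK; last by lin.
rewrite -!/(tlift2 r _); apply: eq_tlift2 => a b c d.
by rewrite ctr_mul_tens !tensDr !tensZr.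
Qed.

Let aybe_term3 x y z r :
  tlift2 (hat r) (fun ui vi uj vj => ctr x uj ⊗ ctr y (mul ui vj) ⊗ ctr z vi) =
  - (omega (dr z x) y *: tlift2 r (fun xi yi xj yj => xj ⊗ dia xi yj ⊗ yi)
     + omega (dl z x) y *: tlift2 r (fun xi yi xj yj => xj ⊗ dia yj xi ⊗ yi)).
Proof.
rewrite /tlift2; under eq_tlift => u v.
  rewrite (tlift_contract_fst
    (F := fun w v' => w ⊗ ctr y (mul u v') ⊗ ctr z v)); last by lin.
  over.
rewrite (tlift_contract_snd (F := fun u w =>
  - tlift (fun a b => a ⊗ ctr y (mul u (x ⊗ b)) ⊗ w) r)); last by lin.
rewrite -!/(tlift2 r _) -!tlift2Z -tlift2D /tlift2.
rewrite -(comp_tlift (h := fun t => - t)); last by lin.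
congr (- _); rewrite -!/(tlift2 r _); apply: eq_tlift2 => a b c d.
by rewrite ctr_mul_tens tensDl tensDr !tensZl !tensZr.
Qed.

(** By invariance of [omega] only [omega x (dr y z)] and [omega x (dl y z)] remain as coefficients;
    what they multiply vanishes by [zybe_fst] and [zybe_snd] respectively. *)
Lemma induced_r_aybe r :
  zinb_invariant dia (r - tflip r) -> zybe dia r -> aybe mul (hat r).
Proof.
move=> r_inv r_zybe; apply: (contract3_inj quadP) => x y z.
rewrite (linear_f0 (linear_tmap _ _)) /aybe -/(tlift2 (hat r) _).
rewrite comp_tlift2; last by lin.
rewrite (@eq_tlift2 _ _ _ _ _ (fun ui vi uj vj =>
    ctr x (mul ui uj) ⊗ ctr y vi ⊗ ctr z vj
    + ctr x ui ⊗ ctr y uj ⊗ ctr z (mul vi vj)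
    - ctr x uj ⊗ ctr y (mul ui vj) ⊗ ctr z vi)); last first.
  by move=> a b c d; rewrite !(tmapD, tmapN) !tmap_tens //; lin.
rewrite !(tlift2D, tlift2N) aybe_term1 aybe_term2 aybe_term3.
rewrite (zybe_fst diaP r_inv r_zybe) (zybe_snd diaP r_inv r_zybe).
rewrite (skew (dr y z)) (skew (dl y z)) (skew (dr z x)) (skew (dl z x)).
rewrite (form_dr_l quadP) (form_dl_l quadP) (form_dr_r quadP y z).
rewrite (form_dl_r quadP y z).
by apply/matrixP => i j; rewrite !mxE; ring.
Qed.

Lemma tsharp_induced_r s xi :
  tsharp (hat s) xi =
  \sum_j tnth f j ⊗ tsharp s (linfun (fun b => xi (tnth e j ⊗ b))).
Proof.
have lin_xi : linear (xi : A -> K^o) by apply: linearP.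
have lin_slice j : linear (fun b => xi (tnth e j ⊗ b) : K^o) by lin.
have lin_lf (V W : vectType K) (h : 'Hom(V, W)) : linear h by apply: linearP.
rewrite /tsharp; move: s; apply: tensor_ext; [by lin | by lin | move=> x y].
rewrite induced_r_tens linear_sum /=; apply: eq_bigr => j _.
have lin_j := lin_lf _ _ (linfun (fun b => xi (tnth e j ⊗ b) : K^o)).
rewrite !tlift_tens; try by lin.
by rewrite linear_lfunE // tensZr.
Qed.

Lemma tsharp_induced_r_iso s :
  linear_iso (tsharp s) -> linear_iso (tsharp (hat s)).
Proof.
move=> [lin_sharp [g gK Kg]]; split.
  move=> k u v; rewrite /tsharp /tlift scaler_sumr -big_split.
  apply: eq_bigr => i _ /=; rewrite scaler_sumr -big_split.
  apply: eq_bigr => j _ /=.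
  rewrite lfunE /= lfunE /= scalerDl scalerDr !scalerA; congr (_ *: _ + _).
  by rewrite /GRing.scale /= mulrCA mulrA.
(* The inverse applies [g] to each [f_j]-coordinate of [a]. As [omega f_j d] is the [e_j]-coordinate
   of [d], the resulting functionals on [B] are glued into one on [D ⊗ B]. *)
pose ext a d b : K^o := \sum_j omega (tnth f j) d * g (ctr (tnth e j) a) b.
have ext_bil a : bilinear_op (ext a).
  split=> [b | d] k u v; rewrite /ext scaler_sumr -big_split /=.
    by apply: eq_bigr => j _; rewrite omega_bil.2 mulrDl -mulrA.
  by apply: eq_bigr => j _; rewrite linearP mulrDr mulrCA.
have ctr_sum k (c : 'I_n -> B) :
    ctr (tnth e k) (\sum_j tnth f j ⊗ c j) = c k.
  rewrite (linear_fsum _ _ _ (lin_ctr _)) (bigD1 k) //= big1 => [|j jk].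
    by rewrite ctr_tens efP.2 eqxx scale1r addr0.
  by rewrite ctr_tens efP.2 (negPf jk) scale0r.
have lin_ext a : linear (tlift (ext a)) by exact: linear_tlift.
exists (fun a => linfun (tlift (ext a))) => [xi | a].
  have lin_xi : linear (xi : A -> K^o) by apply: linearP.
  apply/lfunP => t; rewrite linear_lfunE //; move: t.
  apply: tensor_ext; [by lin | by lin | move=> d b].
  rewrite tlift_tens // /ext tsharp_induced_r.
  rewrite -[in RHS](dual_bases_sum_basis omega_bil efP d).
  rewrite (linear_fsum _ _ _ (linear_tensl _)) (linear_fsum _ _ _ lin_xi).
  apply: eq_bigr => j _; rewrite ctr_sum gK linear_lfunE; last by lin.
  by rewrite tensZl (linear_fZ lin_xi).
rewrite tsharp_induced_r [RHS](contract_reconstruct omega_bil omega_nondeg efP).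
apply: eq_bigr => j _; congr (_ ⊗ _); rewrite -[RHS]Kg; congr tsharp.
apply/lfunP => b; rewrite linear_lfunE; last first.
  by have := linearP (linfun (tlift (ext a))); move=> lin_l; lin.
rewrite linear_lfunE // tlift_tens // /ext (bigD1 j) //= efP.2 eqxx mul1r.
rewrite big1 ?addr0 // => i ij; by rewrite efP.2 (negPf ij) mul0r.
Qed.

Lemma tsharp_induced_r_sum_flip r xi :
  tsharp (hat r) xi + tsharp (tflip (hat r)) xi =
  tsharp (hat (r - tflip r)) xi.
Proof.
by rewrite induced_r_flip -linearD /= -(linear_fB lin_hat).
Qed.

End InducedTensor.

(** * Transport along pointwise equality, and the theorem *)

Lemma eq_asi_bialgebra (K : fieldType) (A : vectType K) (mul : A -> A -> A)
    (Delta Delta' : A -> tensor A A) :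
  Delta =1 Delta' -> asi_bialgebra mul Delta -> asi_bialgebra mul Delta'.
Proof.
move=> DD [bil assoc lin_D coassoc comp1 comp2]; split=> //.
- by move=> k u v; rewrite -!DD lin_D.
- by move=> a; rewrite -!DD -(eq_tmap DD (frefl id)) -(eq_tmap (frefl id) DD).
- by move=> a1 a2; rewrite -!DD comp1.
- by move=> a1 a2; rewrite -!DD comp2.
Qed.

Lemma eq_linear_iso (K : fieldType) (V W : vectType K) (g h : V -> W) :
  g =1 h -> linear_iso g -> linear_iso h.
Proof.
move=> gh [lg bg]; split; first by move=> k u v; rewrite -!gh lg.
exact: eq_bij bg _ gh.
Qed.

Theorem theorem4p20 (K : fieldType) (charK : [pchar K] =i pred0)
  (D B : vectType K)
  (dia : B -> B -> B) (nu : B -> tensor B B)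
  (dl dr : D -> D -> D) (omega : D -> D -> K)
  (thetal thetar : D -> tensor D D) :
  zinbiel_bialgebra dia nu ->
  quadratic_diassociative_algebra dl dr omega ->
  form_coproduct omega dl thetal ->
  form_coproduct omega dr thetar ->
  let mul := induced_mul dl dr dia in
  let Delta := induced_comul thetal thetar nu in
  [/\ forall r : tensor B B,
        zinb_invariant dia (r - tflip r) ->
        nu =1 zinb_cobound dia r ->
        forall (n : nat) (e f : n.-tuple D), dual_bases omega e f ->
        [/\ asi_bialgebra mul Delta,
            asi_bialgebra mul (asi_cobound mul (induced_r e f r))
          & Delta =1 asi_cobound mul (induced_r e f r)],
      zinb_quasitriangular dia nu -> asi_quasitriangular mul Delta,
      zinb_triangular dia nu -> asi_triangular mul Delta
    & zinb_factorizable dia nu -> asi_factorizable mul Delta].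
Proof.
move=> bialgP quadP tlP trP mul Delta.
have diaP := zinb_algebra bialgP; have nuP := zinb_coalgebra bialgP.
have asiP : asi_bialgebra mul Delta by apply: induced_asi_bialgebra tlP trP bialgP.
have [e [f efP]] := dual_bases_exist (quad_bilinear quadP) (quad_nondeg quadP).
have DeltaE r n (e' f' : n.-tuple D) : dual_bases omega e' f' ->
    zinb_invariant dia (r - tflip r) -> nu =1 zinb_cobound dia r ->
    Delta =1 asi_cobound mul (induced_r e' f' r).
  move=> efP' r_inv nuE.
  exact: (induced_cobound_comul quadP diaP efP' nuP tlP trP r_inv nuE).
split.
- move=> r r_inv nuE n e' f' efP'; have DE := DeltaE r n e' f' efP' r_inv nuE.
  by split=> //; apply: eq_asi_bialgebra asiP.
- move=> [_ [r [nuE r_zybe r_inv]]]; split=> //; exists (induced_r e f r).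
  split; [exact: DeltaE | exact: (induced_r_aybe quadP) |].
  exact: (induced_r_sum_flip_invariant quadP).
- move=> [_ [r [nuE r_zybe r_sym]]]; split=> //; exists (induced_r e f r).
  (* For symmetric [r] this difference is zero, so the triangular case satisfies the invariance
     hypothesis of the earlier lemmas. *)
  have r_inv : zinb_invariant dia (r - tflip r).
    move=> b; rewrite r_sym subrr /zinb_cobound.
    by rewrite !(linear_f0 (linear_tmap _ _)) subrr.
  split; [exact: DeltaE | exact: (induced_r_aybe quadP) |].
  by rewrite (induced_r_flip quadP efP) r_sym.
- move=> [_ [r [nuE r_zybe r_inv r_iso]]]; split=> //.
  exists (induced_r e f r); split; [exact: DeltaE | exact: (induced_r_aybe quadP) | |].
    exact: (induced_r_sum_flip_invariant quadP).
  (* Both isomorphism conditions are expressed through the single tensor [r - tau(r)]. *)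
  apply: eq_linear_iso (tsharp_induced_r_iso quadP efP _) => [xi|].
    by rewrite (tsharp_induced_r_sum_flip quadP).
  by apply: eq_linear_iso r_iso => xi; rewrite /tsharp linearB.
Qed.
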